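(* Let $\varphi$ be an Orlicz N-function satisfying Assumption Q. Let $\mathbf X(t)$, $t\in\mathbb R$, be a strictly $Sub_\varphi(\Omega)$ random process with continuous covariance function $R(t,s):=\mathbf E\mathbf X(t)\overline{\mathbf X(s)}$, $\mathbf E\mathbf X(t)=0$ and $\mathbf E|\mathbf X(t)|^2<\infty$ for all $t$. Let $T>0$, $p\ge1$ and suppose that $\int_0^T(\mathbf E(\mathbf X(t))^2)^{p/2}\,dt<+\infty$, that $$\widehat R_2(z,w):=\int_{\mathbb R}\int_{\mathbb R}e^{-izu}e^{-iwv}R(u,v)\,du\,dv$$ exists, and that for some $\alpha>0$ $$\int_{\mathbb R}\int_{\mathbb R}|\widehat R_2(z,w)|\cdot|z|^\alpha\cdot|w|^\alpha\,dz\,dw<\infty .$$ Let $\phi$ be an $f$-wavelet and $\psi$ the corresponding $m$-wavelet, both continuous and both satisfying Assumption S with the function $\Phi$. Let $c:\mathbb R\to\mathbb R$ be an even function, non-decreasing on $[0,\infty)$, with $c(0)>1$, for which there exist $A:(0,\infty)\to(0,\infty)$ and $x_0\in\mathbb R$ such that $c(ax)\le c(x)A(a)$ for all $x\ge x_0$ and all $a>0$. Assume $\int_{\mathbb R}c(x)\Phi(|x|)\,dx<\infty$ and $|R(t,t)|^{1/2}\le c(t)$ for all $t\in\mathbb R$. If $\widehat\psi$ is a Lipschitz function of order $\alpha$ (i.e. $|\widehat\psi(x)-\widehat\psi(y)|\le L|x-y|^{\alpha}$ for some constant $L$ and all $x,y\in\mathbb R$), then $$\sup_{k\in\mathbb Z}(\mathbf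 E|\xi_{0k}|^2)^{1/2}C_\phi+\sum_{j=0}^\infty\sup_{k\in\mathbb Z}(\mathbf E|\eta_{jk}|^2)^{1/2}\,2^{j/2}C_\psi<\infty .$$
   Context: Sub-Gaussian notions. An Orlicz N-function is a continuous even convex function $\varphi:\mathbb R\to\mathbb R$, monotonically increasing for $x>0$, with $\varphi(0)=0$, $\varphi(x)/x\to0$ as $x\to0$ and $\varphi(x)/x\to\infty$ as $x\to\infty$. Assumption Q: $\lim_{x\to0}\varphi(x)/x^2=c_0>0$ (the value $c_0=+\infty$ is allowed). On a probability space $(\Omega,\mathcal B,\mathbf P)$, a zero-mean random variable $\xi$ is in $Sub_\varphi(\Omega)$ if there is $r\ge0$ with $\mathbf E\exp(\lambda\xi)\le\exp(\varphi(r\lambda))$ for all $\lambda\in\mathbb R$; $\tau_\varphi(\xi):=\inf\{a\ge0:\mathbf E\exp(\lambda\xi)\le\exp(\varphi(a\lambda))\ \forall\lambda\in\mathbb R\}$ is a Banach norm on this space. A process $\mathbf X(t)$, $t\in\mathbf T$, is in $Sub_\varphi(\Omega)$ if $\mathbf X(t)\in Sub_\varphi(\Omega)$ for all $t\in\mathbf T$ and $\sup_{t\in\mathbf T}\tau_\varphi(\mathbf X(t))<\infty$. It is strictly $Sub_\varphi(\Omega)$ if there is a constant $C_X>0$ such that for every finite set $I$, $t_i\in\mathbf T$, $\lambda_i\in\mathbb R$, $i\in I$: $\tau_\varphi(\sum_{i\in I}\lambda_i\mathbf X(t_i))\le C_X(\mathbf E(\sum_{i\in I}\lambda_i\mathbf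 X(t_i))^2)^{1/2}$. Wavelets. Fourier transform: $\widehat\phi(y)=\int_{\mathbb R}e^{-iyx}\phi(x)\,dx$. A function $\phi\in L_2(\mathbb R)$ is an $f$-wavelet if $\widehat\phi(0)\ne0$, $\widehat\phi$ is continuous at $0$, $\sum_{k\in\mathbb Z}|\widehat\phi(y+2\pi k)|^2=1$ a.e., and there is a $2\pi$-periodic $m_0\in L_2([0,2\pi])$ with $\widehat\phi(y)=m_0(y/2)\widehat\phi(y/2)$ a.e. The corresponding $m$-wavelet $\psi$ is the inverse Fourier transform of $\widehat\psi(y)=\overline{m_0(y/2+\pi)}\,e^{-iy/2}\,\widehat\phi(y/2)$. Set $\phi_{jk}(x)=2^{j/2}\phi(2^jx-k)$, $\psi_{jk}(x)=2^{j/2}\psi(2^jx-k)$. Assumption S for a function $\delta$, with function $\Phi$: $\Phi:[0,\infty)\to[0,\infty)$ is decreasing, $\Phi(0)<\infty$, $|\delta(x)|\le\Phi(|x|)$ a.e., and $\int_{\mathbb R}\Phi(|x|)\,dx<\infty$. For $\delta\in\{\phi,\psi\}$ put $C_\delta:=3\Phi(0)+4\int_{1/2}^\infty\Phi(t)\,dt$. Wavelet coefficients. $\xi_{0k}:=\int_{\mathbb R}\mathbf X(t)\overline{\phi_{0k}(t)}\,dt$, $\eta_{jk}:=\int_{\mathbb R}\mathbf X(t)\overline{\psi_{jk}(t)}\,dt$ (mean-square integrals), $j\in\mathbb N_0=\{0,1,2,\dots\}$, $k\in\mathbb Z$. *)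

(* Defs.v *)
From HB Require Import structures.
From mathcomp Require Import all_boot all_order all_algebra.
From mathcomp Require Import all_classical all_reals all_analysis.
From mathcomp Require Import complex.

Set Implicit Arguments.
Unset Strict Implicit.
Unset Printing Implicit Defensive.

Import Order.TTheory GRing.Theory Num.Theory.
Import numFieldNormedType.Exports.

Local Open Scope classical_set_scope.
Local Open Scope ring_scope.
Local Open Scope complex_scope.

(* Complex modulus with values in R (`|z| of R[i] has values in R[i]). *)
Notation cabs := ComplexField.Normc.normc.

Definition cmeasurable d (T : measurableType d) (R : realType)
    (D : set T) (f : T -> R[i]) : Prop :=
  measurable_fun D (fun x => complex.Re (f x)) /\
  measurable_fun D (fun x => complex.Im (f x)).

Definition cintegrable d (T : measurableType d) (R : realType)
    (mu : {measure set T -> \bar R}) (D : set T) (f : T -> R[i]) : Prop :=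
  mu.-integrable D (fun x => (complex.Re (f x))%:E) /\
  mu.-integrable D (fun x => (complex.Im (f x))%:E).

Definition cintegral d (T : measurableType d) (R : realType)
    (mu : {measure set T -> \bar R}) (D : set T) (f : T -> R[i]) : R[i] :=
  (\int[mu]_(x in D) complex.Re (f x)) +i* (\int[mu]_(x in D) complex.Im (f x)).

Definition cL2 (R : realType) (D : set R) (f : R -> R[i]) : Prop :=
  cmeasurable D f /\
  (\int[@lebesgue_measure R]_(x in D) (cabs (f x) ^+ 2)%:E < +oo)%E.


Definition expi (R : realType) (x : R) : R[i] := cos x +i* sin x.

Definition N_function (R : realType) (vphi : R -> R) : Prop :=
  [/\ continuous vphi,
      (forall x, vphi (- x) = vphi x),
      convex_function setT (vphi : R^o -> R^o),
      (forall x y, 0 < x -> x <= y -> vphi x <= vphi y) &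
      [/\ vphi 0 = 0,
          vphi x / x @[x --> 0^'] --> (0 : R) &
          vphi x / x @[x --> +oo] --> +oo]].

Definition assumption_Q (R : realType) (vphi : R -> R) : Prop :=
  exists2 c0 : \bar R, (0 < c0)%E &
    (vphi x / x ^+ 2)%:E @[x --> 0^'] --> c0.

Section SubGaussian.
Context d (Omega : measurableType d) (R : realType) (P : probability Omega R).
Implicit Types (vphi : R -> R) (xi : Omega -> R).

Definition exp_bound vphi xi (a : R) : Prop :=
  0 <= a /\
  forall lambda : R, ('M_P xi lambda <= (expR (vphi (a * lambda)))%:E)%E.

Definition in_Sub vphi xi : Prop :=
  [/\ P.-integrable setT (EFin \o xi), ('E_P[xi] = 0)%E &
      exists r : R, exp_bound vphi xi r].

(* The infimum is taken in \bar R, so that it is +oo when no a is admissible. *)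
Definition tau vphi xi : \bar R :=
  ereal_inf (EFin @` [set a | exp_bound vphi xi a]).

Definition lin_comb (X : R -> {RV P >-> R}) n (t lambda : 'I_n -> R)
    (w : Omega) : R :=
  \sum_(i < n) lambda i * X (t i) w.

Definition strictly_Sub vphi (X : R -> {RV P >-> R}) : Prop :=
  (forall t, in_Sub vphi (X t)) /\
  exists2 C : R, 0 < C &
    forall n (t lambda : 'I_n -> R),
      (tau vphi (lin_comb X t lambda) <=
       C%:E * sqrte 'E_P[fun w => (lin_comb X t lambda w ^+ 2)%R])%E.

(* X is real-valued, so no conjugate is needed on the second factor. *)
Definition covfun (X : R -> {RV P >-> R}) (t s : R) : R :=
  fine ('E_P[fun w => (X t w * X s w)%R])%E.

Definition sqnorm2 (Y : Omega -> R[i]) : \bar R :=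
  ('E_P[fun w => (cabs (Y w) ^+ 2)%R])%E.

Definition tagged_partition (a b : R) (n : nat) (t s : nat -> R) : Prop :=
  [/\ t 0%N = a, t n = b &
      forall i, (i < n)%N -> t i <= s i <= t i.+1].

(* Mean-square Riemann integral over [a, b]: limit in L^2(Omega) of the
   Riemann sums as the mesh tends to 0. *)
Definition is_ms_integral_on (Z : R -> Omega -> R[i]) (a b : R)
    (Y : Omega -> R[i]) : Prop :=
  cmeasurable setT Y /\
  forall eps : R, 0 < eps -> exists2 delta : R, 0 < delta &
    forall n (t s : nat -> R), tagged_partition a b n t s ->
      (forall i, (i < n)%N -> t i.+1 - t i < delta) ->
      (sqnorm2 (fun w => (Y w - \sum_(i < n) (t i.+1 - t i)%:C * Z (s i) w)%R)
       < eps%:E)%E.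

(* Improper mean-square integral over the whole line: limit in L^2(Omega) of
   the integrals over [a, b] as a -> -oo and b -> +oo. *)
Definition is_ms_integral (Z : R -> Omega -> R[i]) (Y : Omega -> R[i]) : Prop :=
  cmeasurable setT Y /\
  exists2 I : R -> R -> Omega -> R[i],
    (forall a b, a < b -> is_ms_integral_on Z a b (I a b)) &
    forall eps : R, 0 < eps -> exists2 M : R, 0 < M &
      forall a b, a < - M -> M < b ->
        (sqnorm2 (fun w => (Y w - I a b w)%R) < eps%:E)%E.

End SubGaussian.

Section Wavelets.
Context (R : realType).
Implicit Types (phi psi : R -> R[i]) (Phi : R -> R).

Local Notation mu := (@lebesgue_measure R).

(* Lebesgue integral, meaningful for integrable f. *)
Definition fourier (f : R -> R[i]) (y : R) : R[i] :=
  cintegral mu setT (fun x => expi (- (y * x)) * f x).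

Definition fourier2 (f : R -> R -> R) (z w : R) : R[i] :=
  cintegral (mu \x mu)%E setT
    (fun uv => expi (- (z * uv.1)) * expi (- (w * uv.2)) * (f uv.1 uv.2)%:C).

Definition fourier2_exists (f : R -> R -> R) : Prop :=
  forall z w : R, cintegrable (mu \x mu)%E setT
    (fun uv => expi (- (z * uv.1)) * expi (- (w * uv.2)) * (f uv.1 uv.2)%:C).

Definition refinement_mask phi (m0 : R -> R[i]) : Prop :=
  [/\ (forall y, m0 (y + 2 * pi) = m0 y),
      cL2 `[0, 2 * pi] m0 &
      {ae mu, forall y, fourier phi y = m0 (y / 2) * fourier phi (y / 2)}].

Definition f_wavelet phi : Prop :=
  [/\ cL2 setT phi,
      fourier phi 0 <> 0,
      {for 0, continuous (fourier phi : R -> R[i]^o)},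
      {ae mu, forall y,
        \esum_(k in [set: int])
          (cabs (fourier phi (y + 2 * pi * k%:~R)) ^+ 2)%:E = 1%E} &
      exists m0, refinement_mask phi m0].

(* psi is the inverse Fourier transform of g, i.e. the element of L^2 whose
   Fourier transform is g (equality in L^2 being equality a.e.); the mask m0 is
   determined by phi up to a null set. *)
Definition m_wavelet phi psi : Prop :=
  cL2 setT psi /\
  exists2 m0, refinement_mask phi m0 &
    {ae mu, forall y,
      fourier psi y =
      conjc (m0 (y / 2 + pi)) * expi (- (y / 2)) * fourier phi (y / 2)}.

Definition dyadic phi (j : nat) (k : int) (x : R) : R[i] :=
  (2 `^ (j%:R / 2))%:C * phi (2 ^+ j * x - k%:~R).

(* Only the values of Phi on [0, +oo[ matter. *)
Definition assumption_S Phi (delta : R -> R[i]) : Prop :=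
  [/\ (forall x, 0 <= x -> 0 <= Phi x),
      (forall x y, 0 <= x -> x <= y -> Phi y <= Phi x),
      {ae mu, forall x, cabs (delta x) <= Phi `|x|} &
      (\int[mu]_x (Phi `|x|)%:E < +oo)%E].

(* The constant C_delta; it depends on delta only through Phi. *)
Definition C_S Phi : R :=
  3 * Phi 0 + 4 * \int[mu]_(t in `[2^-1, +oo[) Phi t.

End Wavelets.

(* Main.v *)
(** For an integrable real f and a Poisson kernel the means of f are
    (1/2pi) int e^{-e|z|} f^(z) e^{izu} dz, so Fubini on R^2 x R^2 and e -> 0
    give |int int S(u,v) f(u) f(v)| <= (2pi)^-2 int int |S^(z,w)| |f^(z)| |f^(w)|
    for an integrable kernel S, without assuming S^ or f^ integrable. Applied to
    S = R and to the real and imaginary parts of psi_jk this bounds E|eta_jk|^2,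
    because the Riemann sums of the mean-square integral have second moments that
    are Riemann sums of int int R(u,v) psi_jk(u) conj(psi_jk(v)).

    The scaling relation and |m0(y)|^2 + |m0(y + pi)|^2 = 1 give
    |psi^(2y)|^2 <= |phi^(y)|^2 - |phi^(2y)|^2 a.e., so psi^(0) = 0 by continuity
    at 0. The Lipschitz condition then yields
    |psi_jk^(z)| <= L 2^{-j/2} |z/2^j|^alpha uniformly in k, hence
    (E|eta_jk|^2)^{1/2} 2^{j/2} = O(2^{-j alpha}), a geometric series.
    For the xi_0k the crude bound by Phi(0)^2 times the L^1 norm of R suffices. *)

Require Import Defs.
From HB Require Import structures.
From mathcomp Require Import all_boot all_order all_algebra.
From mathcomp Require Import all_classical all_reals all_analysis.
From mathcomp Require Import complex.
From mathcomp Require Import measurable_realfun ring lra zify.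

Set Implicit Arguments.
Unset Strict Implicit.
Unset Printing Implicit Defensive.

Import Order.TTheory GRing.Theory Num.Theory.
Import numFieldNormedType.Exports.

Local Open Scope classical_set_scope.
Local Open Scope ring_scope.
Local Open Scope complex_scope.

(** * Affine change of variables *)

(** The weight |z|^alpha |w|^alpha vanishes on the axes, so the hypothesis on R^ does not by itself
    make R^ integrable, and R cannot simply be recovered by Fourier inversion. The missing weight is
    supplied by the transforms of psi_jk, which are O(|z|^alpha) at 0; until they are in place,
    every frequency integral carries the damping factor e^{-e(|z| + |w|)}. Integrability of R is the
    existence of R^ at the origin, and it is what legitimises Fubini and the passage e -> 0. Only an
    upper bound of E|eta_jk|^2 is wanted, so a mean-square integral is compared with one fine
    Riemann sum through |y|^2 <= 2|y - z|^2 + 2|z|^2, and the constant lost is harmless. Complex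
    integrals are handled by real and imaginary parts: a real f enters through its cosine and sine
    transforms, and products of complex exponentials appear through their real parts. *)

Section affine_change_of_variable.
Context {R : realType}.
Local Notation mu := (@lebesgue_measure R).
Variables (a b : R).
Hypothesis a0 : a != 0.
Let aff : measurableTypeR R -> measurableTypeR R := fun x => a * x + b.

Lemma measurable_affine : measurable_fun [set: R] (fun x : R => a * x + b).
Proof. by apply: measurable_funD => //; exact: mulrl_measurable. Qed.

Let maff : measurable_fun setT aff := measurable_affine.

(** By uniqueness of Lebesgue measure it suffices to compare both sides on intervals []l, r]]. For
    [a < 0] the preimage is closed at the other end, which leaves its length unchanged. *)
Lemma lebesgue_measure_affine (A : set R) : measurable A ->
  (mu A = `|a|%:E * mu ((fun x : R => (a * x + b)%R) @^-1` A))%E.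
Proof.
have a1 : 0 <= `|a| by [].
move=> mA.
pose m := mscale (NngNum a1) (measure_function_pushforward__canonical__measure_function_Measure
  mu maff).
suff : forall X, ocitv X -> mu X = m X.
  by move=> /(@lebesgue_measure_unique _ m) /(_ _ mA).
move=> _ [[l r] _ <-].
rewrite /m /mscale /= /pushforward.
have [ap|an] := ltP 0 a.
  rewrite (_ : aff @^-1` _ = `](l - b) / a, (r - b) / a]%classic); last first.
    apply/seteqP; split => x /=; rewrite !in_itv/= /aff ltr_pdivrMr// ler_pdivlMr//;
      by rewrite ltrBlDr lerBrDr mulrC.
  rewrite !lebesgue_measure_itv/= !lte_fin ltr_pM2r ?invr_gt0// ltrD2r gtr0_norm//.
  case: ifPn => _; last by rewrite mule0.
  by rewrite -!EFinB -EFinM; congr EFin; field.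
have {}an : a < 0 by rewrite lt_neqAle a0.
rewrite (_ : aff @^-1` _ = `[(r - b) / a, (l - b) / a[%classic); last first.
  apply/seteqP; split => x /=; rewrite !in_itv/= /aff ltr_ndivlMr// ler_ndivrMr//;
    by rewrite ltrBlDr lerBrDr mulrC andbC.
rewrite !lebesgue_measure_itv/= !lte_fin ltr_nM2r ?invr_lt0// ltrD2r ltr0_norm//.
case: ifPn => _; last by rewrite mule0.
by rewrite -!EFinB -EFinM; congr EFin; field.
Qed.

Lemma ge0_integral_affine (f : R -> \bar R) : measurable_fun [set: R] f ->
  (forall x, 0 <= f x)%E ->
  (\int[mu]_x f (a * x + b)%R = (`|a|^-1)%:E * \int[mu]_x f x)%E.
Proof.
have a1 : 0 <= `|a| by [].
move=> mf f0.
pose m := measure_function_pushforward__canonical__measure_function_Measure mu maff.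
have -> : (\int[mu]_x f x = \int[mscale (NngNum a1) m]_x f x)%E.
  by apply: eq_measure_integral => A mA _; exact: lebesgue_measure_affine.
rewrite ge0_integral_mscale//= ge0_integral_pushforward//.
by rewrite muleA -EFinM mulVf ?normr_eq0// mul1e.
Qed.

Lemma integrable_affine (f : R -> R) : mu.-integrable setT (EFin \o f) ->
  mu.-integrable setT (fun x => (f (a * x + b))%:E).
Proof.
move=> /integrableP[mf foo]; apply/integrableP; split.
  exact: (measurableT_comp mf measurable_affine).
rewrite (@ge0_integral_affine (fun x => `|(f x)%:E|%E))//; last first.
  exact: measurableT_comp.
by rewrite lte_mul_pinfty.
Qed.

Lemma Rintegral_affine (f : R -> R) : mu.-integrable setT (EFin \o f) ->
  \int[mu]_x f (a * x + b) = `|a|^-1 * \int[mu]_x f x.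
Proof.
move=> fi; rewrite /Rintegral.
have mf := measurable_int _ fi.
have -> : `|a|^-1 * fine (\int[mu]_x (f x)%:E) = fine ((`|a|^-1)%:E * \int[mu]_x (f x)%:E)%E.
  by rewrite fineM// integrable_fin_num.
congr fine; rewrite [in LHS]integralE [in RHS]integralE muleBr//; last first.
  by apply: fin_num_adde_defr; apply: integrable_pos_fin_num.
congr (_ - _)%E; rewrite -ge0_integral_affine//.
- by apply: eq_integral => x _; rewrite !funeposE.
- exact: measurable_funepos.
- by apply: eq_integral => x _; rewrite !funenegE.
- exact: measurable_funeneg.
Qed.

(** Since [a != 0], the preimage of a null set is null. This transports the a.e. wavelet identities
    to shifted and doubled frequencies. *)
Lemma ae_affine (Q : R -> Prop) : {ae mu, forall x, Q x} ->
  {ae mu, forall x, Q (a * x + b)}.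
Proof.
move=> [A [mA A0 QA]]; exists ((fun x : R => a * x + b) @^-1` A); split.
- by rewrite -[X in measurable X]setTI; exact: measurable_affine.
- have := lebesgue_measure_affine mA; rewrite A0 => /esym/eqP.
  by rewrite mule_eq0 => /orP[/eqP[] /eqP|/eqP//]; rewrite normr_eq0 (negbTE a0).
- by move=> x /= nQ; exact: QA.
Qed.

End affine_change_of_variable.

(** * Dominated convergence and the Poisson kernel *)

Section integrable_real.
Context d (T : measurableType d) (R : realType) (mu : {measure set T -> \bar R}).
Implicit Types f g : T -> R.

Lemma integrable_dominated f g : measurable_fun setT f ->
  mu.-integrable setT (EFin \o g) -> (forall x, `|f x| <= g x) ->
  mu.-integrable setT (EFin \o f).
Proof.
move=> mf ig fg; apply: (le_integrable _ _ _ ig) => //.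
  exact/measurable_EFinP.
by move=> x _ /=; rewrite lee_fin (le_trans (fg x)) ?ler_norm.
Qed.

Lemma integrable_bounded_mul f g (M : R) : measurable_fun setT f ->
  (forall x, `|f x| <= M) -> mu.-integrable setT (EFin \o g) ->
  mu.-integrable setT (fun x => (f x * g x)%:E).
Proof.
move=> mf fM ig.
apply: (@integrable_dominated _ (fun x => M * `|g x|)).
- apply: measurable_funM => //; apply/measurable_EFinP; exact: measurable_int ig.
- have := integrableZl measurableT M (integrable_norm ig).
  by apply: eq_integrable => // x _; rewrite /= EFinM.
- by move=> x; rewrite normrM ler_wpM2r.
Qed.

Lemma cvg_Rintegral_dominated (f_ : nat -> T -> R) f g :
  (forall n, measurable_fun setT (f_ n)) ->
  (forall x, f_ n x @[n --> \oo] --> f x) ->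
  mu.-integrable setT (EFin \o g) ->
  (forall n x, `|f_ n x| <= g x) ->
  \int[mu]_x f_ n x @[n --> \oo] --> \int[mu]_x f x.
Proof.
move=> mf_ cf ig fg.
have mf : measurable_fun setT f.
  by apply: measurable_fun_cvg => [n|x _]; [exact: mf_|exact: cf].
have [] := @dominated_convergence _ T R mu setT measurableT
  (fun n x => (f_ n x)%:E) (EFin \o f) (EFin \o g).
- by move=> n; exact/measurable_EFinP.
- exact/measurable_EFinP.
- by apply: aeW => x _; apply: cvg_EFin; [exact: nearW|exact: cf].
- exact: ig.
- by apply: aeW => x n _; rewrite /= lee_fin.
move=> fi _ cf_; apply: fine_cvg; rewrite fineK ?integrable_fin_num//.
Qed.

End integrable_real.

(** * The cosine transform of e^{-e|z|} and the Cauchy density *)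

Section poisson_kernel.
Context {R : realType}.
Local Notation mu := (@lebesgue_measure R).
Implicit Types e s : R.

Let K e s (z : R) := expR (- (e * `|z|)) * (1 + cos (s * z)).
(* A primitive of [K e s] on [0, +oo[. Adding 1 to the cosine makes the integrand
   nonnegative, as required by the improper fundamental theorem of calculus. *)
Let F e s (z : R) := expR (- (e * z)) *
  ((s * sin (s * z) - e * cos (s * z)) / (e ^+ 2 + s ^+ 2) + - e^-1).

Let dF e s (z : R) : 0 < e -> is_derive z 1 (F e s) (expR (- (e * z)) * (1 + cos (s * z))).
Proof.
move=> e0; rewrite /F.
have es0 : e ^+ 2 + s ^+ 2 != 0 by rewrite gt_eqF// ltr_wpDr ?sqr_ge0// exprn_gt0.
have de : is_derive z 1 (fun z => expR (- (e * z))) (- e * expR (- (e * z))).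
  apply: trigger_derive; rewrite /GRing.scale/=; ring.
have ds : is_derive z 1 (fun z => sin (s * z)) (s * cos (s * z)).
  apply: trigger_derive; rewrite /GRing.scale/=; ring.
have dc : is_derive z 1 (fun z => cos (s * z)) (- s * sin (s * z)).
  apply: trigger_derive; rewrite /GRing.scale/=; ring.
apply: trigger_derive; rewrite /GRing.scale/=.
by field; rewrite es0 gt_eqF.
Qed.

Let normF0 e s : 0 < e -> F e s z @[z --> +oo] --> 0.
Proof.
move=> e0.
pose B := `|s| / (e ^+ 2 + s ^+ 2) + e / (e ^+ 2 + s ^+ 2) + e^-1.
have es0 : 0 < e ^+ 2 + s ^+ 2 by rewrite ltr_wpDr ?sqr_ge0// exprn_gt0.
have cE : expR (- (e * z)) @[z --> +oo] --> (0 : R).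
  by apply: (cvg_comp _ (fun x => expR (- x))); [exact: gt0_cvgMry|exact: cvgr_expR].
have cB : B * expR (- (e * z)) @[z --> +oo] --> (0 : R).
  by rewrite -(mulr0 B); apply: cvgM => //; exact: cvg_cst.
apply: norm_cvg0; apply: (squeeze_cvgr _ (cvg_cst 0) cB).
apply: nearW => z; rewrite normr_ge0 /= /F normrM [leLHS]mulrC (ger0_norm (expR_ge0 _)).
rewrite ler_wpM2r ?expR_ge0// (le_trans (ler_normD _ _))// normrN /B.
have e1 : `|e^-1| = e^-1 by rewrite ger0_norm// invr_ge0 ltW.
rewrite e1 lerD2r.
rewrite normrM normfV (gtr0_norm es0) -mulrDl ler_wpM2r ?invr_ge0 ?(ltW es0)//.
rewrite (le_trans (ler_normB _ _))// !normrM (gtr0_norm e0).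
have sin1 : `|sin (s * z)| <= 1 by rewrite ler_norml sin_geN1 sin_le1.
have cos1 : `|cos (s * z)| <= 1 by rewrite ler_norml cos_geN1 cos_le1.
by rewrite lerD// ler_piMr// ltW.
Qed.

Let cK e s : continuous (K e s).
Proof.
move=> z; rewrite /K; apply: cvgM; last first.
  apply: cvgD; first exact: cvg_cst.
  by apply: (cvg_comp _ cos); [apply: cvgMr; exact: cvg_id|exact: continuous_cos].
apply: (cvg_comp _ expR); last exact: continuous_expR.
by apply: cvgN; apply: cvgMr; exact: norm_continuous.
Qed.

Let K_ge0 e s z : 0 <= K e s z.
Proof. by rewrite mulr_ge0 ?expR_ge0// -lerBlDl sub0r cos_geN1. Qed.

(** Evenness reduces to the half-line; [F e s] tends to 0 at infinity, so the half-line integral is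
    [- F e s 0]. *)
Let integralK e s : 0 < e ->
  (\int[mu]_z (K e s z)%:E = (2 * (e / (e ^+ 2 + s ^+ 2) + e^-1))%:E)%E.
Proof.
move=> e0.
rewrite ge0_symfun_integralT; [|exact: K_ge0|exact: cK|]; last first.
  by move=> x; rewrite /K/= normrN mulrN cosN.
rewrite EFinM; congr (_ * _)%E; rewrite -set_itvcy.
have dF0 x : derivable (F e s) x 1 by have [] := dF s x e0.
rewrite (ge0_continuous_FTC2y _ _ (normF0 s e0)).
- rewrite /F !mulr0 oppr0 expR0 sin0 cos0 -EFinB; congr EFin; field.
  by rewrite gt_eqF// ?gt_eqF// ltr_wpDr ?sqr_ge0// exprn_gt0.
- by move=> x _; exact: K_ge0.
- by apply: continuous_subspaceT; exact: cK.
- by move=> x _.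
- by apply: cvg_at_right_filter; apply: differentiable_continuous; exact/derivable1_diffP.
- move=> x; rewrite in_itv/= andbT => x0; have [_] := dF s x e0.
  by rewrite derive1E => ->; rewrite /K gtr0_norm.
Qed.

Let integrableK e s : 0 < e -> mu.-integrable setT (fun z => (K e s z)%:E).
Proof.
move=> e0; apply/integrableP; split.
  by apply/measurable_EFinP; apply: continuous_measurable_fun; exact: cK.
under eq_integral do rewrite gee0_abs ?lee_fin ?K_ge0//.
by rewrite integralK// ltry.
Qed.

Lemma continuous_expR_abs e : continuous (fun z : R => expR (- (e * `|z|))).
Proof.
move=> z; apply: (cvg_comp _ expR); last exact: continuous_expR.
by apply: cvgN; apply: cvgMr; exact: norm_continuous.
Qed.

Lemma integrable_expR_abs e : 0 < e ->
  mu.-integrable setT (fun z => (expR (- (e * `|z|)))%:E).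
Proof.
move=> e0; have := integrableZl measurableT (2^-1) (integrableK 0 e0).
apply: eq_integrable => // z _; rewrite /= /K mul0r cos0 -EFinM; congr EFin; by field.
Qed.

Lemma integrable_expR_abs_cos e s : 0 < e ->
  mu.-integrable setT (fun z => (expR (- (e * `|z|)) * cos (s * z))%:E).
Proof.
move=> e0; have := integrableB measurableT (integrableK s e0) (integrable_expR_abs e0).
by apply: eq_integrable => // z _; rewrite /K -EFinB; congr EFin; ring.
Qed.

(** [K e 0] is twice the exponential, whose integral is therefore 2/e; subtracting the exponential
    from [K e s] removes the 1 that was added to the cosine. *)
Lemma Rintegral_expR_abs_cos e s : 0 < e ->
  \int[mu]_z (expR (- (e * `|z|)) * cos (s * z)) = 2 * (e / (e ^+ 2 + s ^+ 2)).
Proof.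
move=> e0.
have R0 : \int[mu]_z (expR (- (e * `|z|))) = 2 * e^-1.
  transitivity (\int[mu]_z (2^-1 * K e 0 z)).
    by apply: eq_Rintegral => z _; rewrite /K mul0r cos0; field.
  rewrite RintegralZl//; last exact: integrableK.
  rewrite /Rintegral integralK//=; field.
  by rewrite gt_eqF.
transitivity (\int[mu]_z (K e s z - expR (- (e * `|z|)))).
  by apply: eq_Rintegral => z _; rewrite /K; ring.
rewrite RintegralB//; [|exact: integrableK|exact: integrable_expR_abs].
by rewrite R0 /Rintegral integralK//=; ring.
Qed.

Lemma integral_oneDsqrV : (\int[mu]_x ((1 + x ^+ 2)^-1)%:E = pi%:E)%E.
Proof.
rewrite ge0_symfun_integralT.
- rewrite -set_itvcy integral0y_oneDsqr -EFinM; congr EFin; by field.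
- by move=> x; rewrite invr_ge0 addr_ge0 ?sqr_ge0//.
- exact: continuous_oneDsqrV.
- by move=> x /=; rewrite sqrrN.
Qed.

Lemma integrable_oneDsqrV : mu.-integrable setT (fun x : R => ((1 + x ^+ 2)^-1)%:E).
Proof.
apply/integrableP; split.
  by apply/measurable_EFinP; apply: continuous_measurable_fun; exact: continuous_oneDsqrV.
under eq_integral do rewrite gee0_abs ?lee_fin ?invr_ge0 ?addr_ge0 ?sqr_ge0//.
by rewrite integral_oneDsqrV ltry.
Qed.
End poisson_kernel.

(** * Fubini for real-valued integrals *)

Section product_measure_sigma_finite.
Context d1 d2 (T1 : measurableType d1) (T2 : measurableType d2) (R : realType).
Variable m1 : {sigma_finite_measure set T1 -> \bar R}.
Variable m2 : {sigma_finite_measure set T2 -> \bar R}.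

Lemma product_sigma_finite : sigma_finite setT (m1 \x m2)%E.
Proof.
have /sigma_finiteP[F [TF ndF Foo]] := sigma_finiteT m1.
have /sigma_finiteP[G [TG ndG Goo]] := sigma_finiteT m2.
exists (fun n => F n `*` G n) => [|n].
  rewrite -setXTT TF TG; apply/seteqP; split.
    move=> [x y] /= [[n _ Fx] [k _ Gy]].
    by exists (maxn n k) => //; split; [move: x Fx; apply/subsetPset/ndF/leq_maxl|
      move: y Gy; apply/subsetPset/ndG/leq_maxr].
  by move=> [x y] [n _ [Fx Gy]]; split; exists n.
have [mF Foon] := Foo n; have [mG Goon] := Goo n.
by split; [exact: measurableX|rewrite product_measure1E// lte_mul_pinfty// ge0_fin_numE].
Qed.

End product_measure_sigma_finite.
Section plane_measure.
Context {R : realType}.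
Local Notation mR := (measurableTypeR R).

(* The library declares no canonical sigma-finite structure on [mu \x mu]; this
   convertible constant carries one. *)
Definition plane_measure : set (mR * mR) -> \bar R :=
  (@lebesgue_measure R \x @lebesgue_measure R)%E.
HB.instance Definition _ := Measure.on plane_measure.
HB.instance Definition _ := Measure_isSigmaFinite.Build _ _ _ plane_measure
   (product_sigma_finite (@lebesgue_measure R) (@lebesgue_measure R)).
End plane_measure.

Section real_fubini.
Context d1 d2 (T1 : measurableType d1) (T2 : measurableType d2) (R : realType).
Variable m1 : {sigma_finite_measure set T1 -> \bar R}.
Variable m2 : {sigma_finite_measure set T2 -> \bar R}.

(** Tonelli gives measurability of the integrals of the positive and negative parts in [\bar R];
    their difference is formed there and [fine] is applied last. *)
Lemma measurable_Rintegral_param (f : T1 * T2 -> R) : measurable_fun setT f ->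
  measurable_fun setT (fun x => \int[m2]_y f (x, y)).
Proof.
move=> mf; apply: measurableT_comp => //.
have mEf : measurable_fun setT (EFin \o f) by exact/measurable_EFinP.
rewrite (_ : (fun x => _) = (fun x => \int[m2]_y (EFin \o f)^\+ (x, y)) \-
  (fun x => \int[m2]_y (EFin \o f)^\- (x, y)))%E; last first.
  by apply/funext => x; rewrite [LHS]integralE/=; congr (_ - _)%E;
    apply: eq_integral => y _; rewrite ?funeposE ?funenegE.
apply: emeasurable_funB.
  by apply: (@measurable_fun_fubini_tonelli_F _ _ _ _ _ m2 (EFin \o f)^\+%E) => //;
    exact: measurable_funepos.
by apply: (@measurable_fun_fubini_tonelli_F _ _ _ _ _ m2 (EFin \o f)^\-%E) => //;
  exact: measurable_funeneg.
Qed.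

Lemma integrable_tensor (f : T1 -> R) (g : T2 -> R) :
  m1.-integrable setT (EFin \o f) -> m2.-integrable setT (EFin \o g) ->
  (m1 \x m2)%E.-integrable setT (fun z => (f z.1 * g z.2)%:E).
Proof.
move=> fi gi.
have mf : measurable_fun setT f by apply/measurable_EFinP; exact: measurable_int fi.
have mg : measurable_fun setT g by apply/measurable_EFinP; exact: measurable_int gi.
apply/integrable12ltyP.
  by apply/measurable_EFinP; apply: measurable_funM; exact: measurableT_comp.
have gfin : (\int[m2]_y (`|g y|)%:E)%E \is a fin_num.
  exact/integrable_fin_num/integrable_norm.
under eq_integral => x _.
  under eq_integral => y _ do rewrite /= normrM EFinM.
  rewrite ge0_integralZl//; last by apply/measurable_EFinP; exact: measurableT_comp.
  over.
rewrite /= ge0_integralZr//; last 2 first.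
- by apply/measurable_EFinP; exact: measurableT_comp.
- exact: integral_ge0.
apply: lte_mul_pinfty => //; first exact: integral_ge0.
  exact/integrable_fin_num/integrable_norm.
by rewrite ltey_eq gfin.
Qed.

Lemma integrable_bounded_mul_tensor (h : T1 * T2 -> R) (f : T1 -> R) (g : T2 -> R) (M : R) :
  measurable_fun setT h -> (forall z, `|h z| <= M) ->
  m1.-integrable setT (EFin \o f) -> m2.-integrable setT (EFin \o g) ->
  (m1 \x m2)%E.-integrable setT (fun z => (h z * (f z.1 * g z.2))%:E).
Proof.
move=> mh hM fi gi; apply: (@integrable_bounded_mul _ _ _ (m1 \x m2)%E) => //.
exact: integrable_tensor.
Qed.

(** Integrability of every section lets [fine] be removed from the inner integrals at every point,
    so no exceptional null set has to be carried along. *)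
Lemma Rintegral_fubini (f : T1 * T2 -> R) :
  (m1 \x m2)%E.-integrable setT (EFin \o f) ->
  (forall x, m2.-integrable setT (fun y => (f (x, y))%:E)) ->
  (forall y, m1.-integrable setT (fun x => (f (x, y))%:E)) ->
  \int[m1]_x (\int[m2]_y f (x, y)) = \int[m2]_y (\int[m1]_x f (x, y)).
Proof.
move=> fi f1 f2; rewrite /Rintegral; congr fine.
transitivity (\int[m1]_x \int[m2]_y (f (x, y))%:E)%E.
  by apply: eq_integral => x _; rewrite fineK// integrable_fin_num.
transitivity (\int[m2]_y \int[m1]_x (f (x, y))%:E)%E.
  exact: (Fubini fi).
by apply: eq_integral => y _; rewrite fineK// integrable_fin_num.
Qed.

Lemma Rintegral_product (f : T1 * T2 -> R) :
  (m1 \x m2)%E.-integrable setT (EFin \o f) ->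
  (forall x, m2.-integrable setT (fun y => (f (x, y))%:E)) ->
  \int[(m1 \x m2)%E]_z f z = \int[m1]_x (\int[m2]_y f (x, y)).
Proof.
move=> fi f1; rewrite /Rintegral -(integral12_prod_meas1 fi); congr fine.
by apply: eq_integral => x _; rewrite fineK// integrable_fin_num.
Qed.

Lemma Rintegral_tensor (f : T1 -> R) (g : T2 -> R) :
  m1.-integrable setT (EFin \o f) -> m2.-integrable setT (EFin \o g) ->
  \int[(m1 \x m2)%E]_z (f z.1 * g z.2) = (\int[m1]_x f x) * (\int[m2]_y g y).
Proof.
move=> fi gi; rewrite Rintegral_product; last 2 first.
- exact: integrable_tensor.
- move=> x; have := integrableZl measurableT (f x) gi.
  by apply: eq_integrable => // y _; rewrite /= EFinM.
rewrite -RintegralZr//; apply: eq_Rintegral => x _ /=.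
by rewrite RintegralZl.
Qed.

Lemma integrable_Rintegral (f : T1 * T2 -> R) :
  (m1 \x m2)%E.-integrable setT (EFin \o f) ->
  (forall x, m2.-integrable setT (fun y => (f (x, y))%:E)) ->
  m1.-integrable setT (fun x => (\int[m2]_y f (x, y))%:E).
Proof.
move=> fi f1; have := integrable_fubini_F fi.
by apply: eq_integrable => // x _; rewrite /fubini_F /Rintegral fineK// integrable_fin_num.
Qed.

End real_fubini.

(* Lebesgue measure lives on [measurableTypeR R], whose measurable structure is
   convertible to that of [R] but does not unify with it; these instances fix the
   types so that functions on [R] can be used directly. *)
Section integrable_lebesgue.
Context {R : realType}.
Local Notation mu := (@lebesgue_measure R).

Lemma integrable_bounded_mulR (f g : R -> R) (M : R) : measurable_fun setT f ->
  (forall x, `|f x| <= M) -> mu.-integrable setT (EFin \o g) ->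
  mu.-integrable setT (fun x => (f x * g x)%:E).
Proof. exact: (@integrable_bounded_mul _ _ _ mu). Qed.

Lemma integrable_bounded_mulRR (f g : R * R -> R) (M : R) : measurable_fun setT f ->
  (forall x, `|f x| <= M) -> (mu \x mu)%E.-integrable setT (EFin \o g) ->
  (mu \x mu)%E.-integrable setT (fun x => (f x * g x)%:E).
Proof. exact: (@integrable_bounded_mul _ _ _ (mu \x mu)%E). Qed.

Lemma integrable_dominatedR (f g : R -> R) : measurable_fun setT f ->
  mu.-integrable setT (EFin \o g) -> (forall x, `|f x| <= g x) ->
  mu.-integrable setT (EFin \o f).
Proof. exact: (@integrable_dominated _ _ _ mu). Qed.

Lemma cvg_Rintegral_dominatedR (f_ : nat -> R -> R) (f g : R -> R) :
  (forall n, measurable_fun setT (f_ n)) ->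
  (forall x, f_ n x @[n --> \oo] --> f x) ->
  mu.-integrable setT (EFin \o g) ->
  (forall n x, `|f_ n x| <= g x) ->
  \int[mu]_x f_ n x @[n --> \oo] --> \int[mu]_x f x.
Proof. exact: (@cvg_Rintegral_dominated _ _ _ mu). Qed.

Lemma cvg_Rintegral_dominatedRR (f_ : nat -> R * R -> R) (f g : R * R -> R) :
  (forall n, measurable_fun setT (f_ n)) ->
  (forall x, f_ n x @[n --> \oo] --> f x) ->
  (mu \x mu)%E.-integrable setT (EFin \o g) ->
  (forall n x, `|f_ n x| <= g x) ->
  \int[(mu \x mu)%E]_x f_ n x @[n --> \oo] --> \int[(mu \x mu)%E]_x f x.
Proof. exact: (@cvg_Rintegral_dominated _ _ _ (mu \x mu)%E). Qed.

Lemma integrable_measurableRR (f : R * R -> R) : (mu \x mu)%E.-integrable setT (EFin \o f) ->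
  measurable_fun setT f.
Proof. by move=> ii; have /measurable_EFinP := measurable_int _ ii. Qed.

End integrable_lebesgue.

(** * Poisson means and a Parseval inequality *)

Section poisson_means.
Context {R : realType}.
Local Notation mu := (@lebesgue_measure R).
Variables (a : R -> R) (B : R).
Hypotheses (ca : continuous a) (aB : forall x, `|a x| <= B)
  (ia : mu.-integrable setT (EFin \o a)).

(** For real [a] the Fourier transform is the cosine transform minus i times the sine transform;
    keeping the two apart leaves all integrals real. *)
Definition cos_transform (z : R) : R := \int[mu]_x (a x * cos (z * x)).
Definition sin_transform (z : R) : R := \int[mu]_x (a x * sin (z * x)).

Lemma measurable_cosM (c : R) : measurable_fun [set: R] (fun x => cos (c * x)).
Proof.
apply: (measurableT_comp (f := @cos R)); last exact: mulrl_measurable.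
by apply: continuous_measurable_fun; exact: continuous_cos.
Qed.

Lemma measurable_sinM (c : R) : measurable_fun [set: R] (fun x => sin (c * x)).
Proof.
apply: (measurableT_comp (f := @sin R)); last exact: mulrl_measurable.
by apply: continuous_measurable_fun; exact: continuous_sin.
Qed.

Lemma normr_cos (x : R) : `|cos x| <= 1.
Proof. by rewrite ler_norml cos_geN1 cos_le1. Qed.

Lemma normr_sin (x : R) : `|sin x| <= 1.
Proof. by rewrite ler_norml sin_geN1 sin_le1. Qed.

Lemma integrable_mul_cos (z : R) : mu.-integrable setT (fun x => (a x * cos (z * x))%:E).
Proof.
under eq_fun do rewrite mulrC.
apply: (integrable_bounded_mulR (f := fun x => cos (z * x)) (M := 1)) => //.
  exact: measurable_cosM.
by move=> x; exact: normr_cos.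
Qed.

Lemma integrable_mul_sin (z : R) : mu.-integrable setT (fun x => (a x * sin (z * x))%:E).
Proof.
under eq_fun do rewrite mulrC.
apply: (integrable_bounded_mulR (f := fun x => sin (z * x)) (M := 1)) => //.
  exact: measurable_sinM.
by move=> x; exact: normr_sin.
Qed.

(** This is int e^{-e|z|} a^(z) e^{iuz} dz, whose integrand has an odd imaginary part. The factor
    1/(2 pi) is left out, so the limit as e -> 0 is 2 pi a(u). *)
Definition poisson_mean (e u : R) : R := \int[mu]_z (expR (- (e * `|z|)) *
  (cos_transform z * cos (u * z) + sin_transform z * sin (u * z))).

Let transform_shift u z : cos_transform z * cos (u * z) + sin_transform z * sin (u * z) =
  \int[mu]_x (a x * cos ((u - x) * z)).
Proof.
rewrite /cos_transform /sin_transform -RintegralZr//; last exact: integrable_mul_cos.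
rewrite -RintegralZr//; last exact: integrable_mul_sin.
rewrite -RintegralD//; last 2 first.
- have := integrableZr measurableT (cos (u * z)) (integrable_mul_cos z).
  by apply: eq_integrable => // x _; rewrite /= EFinM.
- have := integrableZr measurableT (sin (u * z)) (integrable_mul_sin z).
  by apply: eq_integrable => // x _; rewrite /= EFinM.
apply: eq_Rintegral => x _; rewrite mulrBl cosB; rewrite (mulrC x z); ring.
Qed.

(** Fubini turns the damping into the Poisson kernel 2e / (e^2 + (u - x)^2), and x = e s + u turns
    that into a fixed multiple of the Cauchy density. The parameter [e] then occurs only inside [a],
    so B / (1 + s^2) dominates for all [e] at once. *)
Lemma poisson_meanE e u : 0 < e ->
  poisson_mean e u = 2 * \int[mu]_s (a (e * s + u) * (1 + s ^+ 2)^-1).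
Proof.
move=> e0; rewrite /poisson_mean.
have mf : measurable_fun setT (fun zx : R * R => cos ((u - zx.2) * zx.1)).
  apply: (measurableT_comp (f := @cos R)).
    by apply: continuous_measurable_fun; exact: continuous_cos.
  apply: measurable_funM => //.
  exact: measurable_funB.
have iK := integrable_expR_abs e0.
have bc := fun zx : R * R => normr_cos ((u - zx.2) * zx.1).
pose f := fun zx : R * R => cos ((u - zx.2) * zx.1) * (expR (- (e * `|zx.1|)) * a zx.2).
transitivity (\int[mu]_z \int[mu]_x f (z, x)).
  apply: eq_Rintegral => z _; rewrite transform_shift -RintegralZl//.
    by apply: eq_Rintegral => x _; rewrite /f/=; ring.
  under eq_fun do rewrite mulrC.
  apply: (integrable_bounded_mulR (f := fun x => cos ((u - x) * z)) (M := 1)) => //.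
    exact: (measurable_fun_pair2 z mf).
  by move=> x; exact: normr_cos.
rewrite Rintegral_fubini; last 3 first.
- apply: (integrable_bounded_mulRR (f := fun zx : R * R => cos ((u - zx.2) * zx.1)) (M := 1)).
  + exact: mf.
  + exact: bc.
  + exact: integrable_tensor iK ia.
- move=> z; apply: (integrable_bounded_mulR (f := fun x => cos ((u - x) * z)) (M := 1)).
  + exact: (measurable_fun_pair2 z mf).
  + by move=> x; exact: normr_cos.
  + have := integrableZl measurableT (expR (- (e * `|z|))) ia.
    by apply: eq_integrable => // x _; rewrite /= EFinM.
- move=> x; apply: (integrable_bounded_mulR (f := fun z => cos ((u - x) * z)) (M := 1)).
  + exact: (measurable_fun_pair1 x mf).
  + by move=> z; exact: normr_cos.
  + have := integrableZr measurableT (a x) iK.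
    by apply: eq_integrable => // z _; rewrite /= EFinM.
(* The kernel factor is at most 1/e because its denominator is at least e^2. *)
have iP : mu.-integrable setT (fun x => ((e / (e ^+ 2 + (u - x) ^+ 2)) * a x)%:E).
  apply: (integrable_bounded_mulR (M := e^-1)) => //.
    apply: measurable_funM => //; apply: continuous_measurable_fun => x.
    apply: cvgV; first by rewrite gt_eqF// ltr_wpDr ?sqr_ge0// exprn_gt0.
    apply: cvgD; first exact: cvg_cst.
    apply: (cvg_comp (fun x => u - x) (fun y => y ^+ 2)); last exact: exprn_continuous.
    by apply: cvgB; [exact: cvg_cst|exact: cvg_id].
  move=> x; have ee : 0 < e ^+ 2 + (u - x) ^+ 2 by rewrite ltr_wpDr ?sqr_ge0// exprn_gt0.
  rewrite ger0_norm; last by rewrite divr_ge0 ?ltW.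
  rewrite ler_pdivrMr// mulrDr expr2 mulrA mulVf ?gt_eqF// mul1r.
  by rewrite lerDl mulr_ge0// ?sqr_ge0 ?invr_ge0 ?ltW.
transitivity (\int[mu]_x (2 * ((e / (e ^+ 2 + (u - x) ^+ 2)) * a x))).
  apply: eq_Rintegral => x _.
  transitivity (\int[mu]_z ((expR (- (e * `|z|)) * cos ((u - x) * z)) * a x)).
    by apply: eq_Rintegral => z _; rewrite /f/=; ring.
  rewrite RintegralZr//; last exact: integrable_expR_abs_cos.
  by rewrite Rintegral_expR_abs_cos// -[LHS]mulrA.
rewrite RintegralZl//; congr (_ * _).
(* Substitution x = e s + u. Multiplying by [e] clears the Jacobian, and e^2 / (e^2 + e^2 s^2) = 1 /
   (1 + s^2). *)
have := Rintegral_affine u (lt0r_neq0 e0) iP; rewrite gtr0_norm// => /(congr1 ( *%R e)).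
rewrite mulrA mulfV ?gt_eqF// mul1r => <-.
rewrite -RintegralZl//.
  apply: eq_Rintegral => s _; rewrite mulrCA [RHS]mulrC mulrA; congr (_ * _).
  rewrite opprD addrCA subrr addr0 sqrrN exprMn.
  have s1 : 1 + s ^+ 2 != 0 by rewrite gt_eqF// ltr_wpDr ?sqr_ge0.
  have es1 : e ^+ 2 + e ^+ 2 * s ^+ 2 != 0.
    by rewrite gt_eqF// ltr_wpDr// ?exprn_gt0// mulr_ge0 ?sqr_ge0.
  by field; rewrite s1 exprMn es1.
exact: (integrable_affine u (lt0r_neq0 e0) iP).
Qed.

Let ma : measurable_fun setT a.
Proof. exact: continuous_measurable_fun. Qed.

Let maff (e u : R) : measurable_fun [set: R] (fun s : R => a (e * s + u) * (1 + s ^+ 2)^-1).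
Proof.
apply: measurable_funM.
  exact: (measurableT_comp ma (measurable_affine e u)).
by apply: continuous_measurable_fun; exact: continuous_oneDsqrV.
Qed.

Let dom (e u s : R) : `|a (e * s + u) * (1 + s ^+ 2)^-1| <= B * (1 + s ^+ 2)^-1.
Proof.
have s0 : 0 <= (1 + s ^+ 2)^-1 by rewrite invr_ge0 addr_ge0 ?sqr_ge0.
by rewrite normrM (ger0_norm s0) ler_wpM2r.
Qed.

Let iBdom : mu.-integrable setT (fun s : R => (B * (1 + s ^+ 2)^-1)%:E).
Proof.
have := integrableZl measurableT B (@integrable_oneDsqrV R).
by apply: eq_integrable => // x _; rewrite /= EFinM.
Qed.

Lemma poisson_mean_bounded e u : 0 < e -> `|poisson_mean e u| <= 2 * (B * pi).
Proof.
move=> e0; rewrite poisson_meanE// normrM ger0_norm// ler_wpM2l//.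
have ii := integrable_dominatedR (maff e u) iBdom (dom e u).
rewrite (le_trans (le_normr_Rintegral _ ii))//.
have -> : B * pi = \int[mu]_s (B * (1 + s ^+ 2)^-1).
  rewrite RintegralZl//; last exact: integrable_oneDsqrV.
  congr (_ * _).
  by rewrite /Rintegral integral_oneDsqrV.
by apply: le_Rintegral => //; exact: integrable_norm.
Qed.

Lemma cvg_poisson_mean u : poisson_mean n.+1%:R^-1 u @[n --> \oo] --> 2 * (a u * pi).
Proof.
under eq_fun do rewrite poisson_meanE ?invr_gt0//.
apply: cvgMr.
have -> : a u * pi = \int[mu]_s (a u * (1 + s ^+ 2)^-1).
  rewrite RintegralZl//; last exact: integrable_oneDsqrV.
  congr (_ * _).
  by rewrite /Rintegral integral_oneDsqrV.
apply: (cvg_Rintegral_dominatedR (fun n => maff _ _) _ iBdom) => [s|n s]; last exact: dom.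
apply: cvgMl.
apply: (cvg_comp _ a (G := nbhs u)); last exact: ca.
have {2}-> : u = 0 * s + u by rewrite mul0r add0r.
by apply: cvgD; [apply: cvgMl; exact: cvg_harmonic|exact: cvg_cst].
Qed.

End poisson_means.

(** * The Parseval inequality for an integrable kernel *)

Section parseval_bound.
Context {R : realType}.
Local Notation mu := (@lebesgue_measure R).
Local Notation mu2 := (mu \x mu)%E.
Local Notation sf2 := (@plane_measure R).

Lemma normc_ReIm (z : R[i]) : cabs z = Num.sqrt (complex.Re z ^+ 2 + complex.Im z ^+ 2).
Proof. by case: z. Qed.

Lemma Re_fourier2 (S : R -> R -> R) z w : complex.Re (fourier2 S z w) =
  \int[mu2]_uv (S uv.1 uv.2 * cos (z * uv.1 + w * uv.2)).
Proof.
apply: eq_Rintegral => -[u v] _ /=.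
by rewrite !cosN !sinN cosD; ring.
Qed.

Lemma Im_fourier2 (S : R -> R -> R) z w : complex.Im (fourier2 S z w) =
  \int[mu2]_uv (- (S uv.1 uv.2 * sin (z * uv.1 + w * uv.2))).
Proof.
apply: eq_Rintegral => -[u v] _ /=.
by rewrite !cosN !sinN sinD; ring.
Qed.

Lemma measurable_cos : measurable_fun setT (@cos R).
Proof. by apply: continuous_measurable_fun; exact: continuous_cos. Qed.

Lemma measurable_sin : measurable_fun setT (@sin R).
Proof. by apply: continuous_measurable_fun; exact: continuous_sin. Qed.

Variables (a : R -> R) (B : R).
Hypotheses (ca : continuous a) (aB : forall x, `|a x| <= B)
  (ia : mu.-integrable setT (EFin \o a)).
Local Notation Ac := (cos_transform a).
Local Notation As := (sin_transform a).

Lemma measurable_cos_transform : measurable_fun setT Ac.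
Proof.
apply: (@measurable_Rintegral_param _ _ _ _ _ mu (fun zx : R * R => a zx.2 * cos (zx.1 * zx.2))).
apply: measurable_funM.
  by apply: measurableT_comp => //; exact: continuous_measurable_fun.
by apply: (measurableT_comp measurable_cos); exact: measurable_funM.
Qed.

Lemma measurable_sin_transform : measurable_fun setT As.
Proof.
apply: (@measurable_Rintegral_param _ _ _ _ _ mu (fun zx : R * R => a zx.2 * sin (zx.1 * zx.2))).
apply: measurable_funM.
  by apply: measurableT_comp => //; exact: continuous_measurable_fun.
by apply: (measurableT_comp measurable_sin); exact: measurable_funM.
Qed.

Let N := \int[mu]_x `|a x|.

Lemma cos_transform_bounded z : `|Ac z| <= N.
Proof.
have ii := integrable_mul_cos ia z.
rewrite (le_trans (le_normr_Rintegral _ ii))//.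
apply: le_Rintegral => //; [exact: integrable_norm|exact: integrable_norm|].
by move=> x _; rewrite normrM ler_piMr ?normr_cos.
Qed.

Lemma sin_transform_bounded z : `|As z| <= N.
Proof.
have ii := integrable_mul_sin ia z.
rewrite (le_trans (le_normr_Rintegral _ ii))//.
apply: le_Rintegral => //; [exact: integrable_norm|exact: integrable_norm|].
by move=> x _; rewrite normrM ler_piMr ?normr_sin.
Qed.

Let K e (z : R) := expR (- (e * `|z|)).
(* [K (Ac + i As)(z) e^{-iuz} = F + i G]; [G] is odd in [z], so the product of two
   Poisson means is the integral of [F F - G G], the real part of the product. *)
Let F e u z := K e z * (Ac z * cos (u * z) + As z * sin (u * z)).
Let G e u z := K e z * (As z * cos (u * z) - Ac z * sin (u * z)).

Let measurable_K e : measurable_fun setT (K e).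
Proof. apply: continuous_measurable_fun; exact: continuous_expR_abs. Qed.

Let integrable_F e u : 0 < e -> mu.-integrable setT (EFin \o F e u).
Proof.
move=> e0; have iK := integrable_expR_abs e0.
have := @integrable_bounded_mulR R (fun z => Ac z * cos (u * z) + As z * sin (u * z)) _
  (N + N) _ _ iK.
move=> h; have := h _ _ => {}h.
rewrite /F; under [X in integrable _ _ X]eq_fun do rewrite mulrC.
apply: h.
  apply: measurable_funD; apply: measurable_funM.
  - exact: measurable_cos_transform.
  - exact: measurable_cosM.
  - exact: measurable_sin_transform.
  - exact: measurable_sinM.
move=> z; rewrite (le_trans (ler_normD _ _))// lerD// normrM.
  by rewrite (le_trans _ (cos_transform_bounded z))// ler_piMr ?normr_cos.
by rewrite (le_trans _ (sin_transform_bounded z))// ler_piMr ?normr_sin.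
Qed.

Let integrable_G e u : 0 < e -> mu.-integrable setT (EFin \o G e u).
Proof.
move=> e0; have iK := integrable_expR_abs e0.
have := @integrable_bounded_mulR R (fun z => As z * cos (u * z) - Ac z * sin (u * z)) _
  (N + N) _ _ iK.
move=> h; have := h _ _ => {}h.
rewrite /G; under [X in integrable _ _ X]eq_fun do rewrite mulrC.
apply: h.
  apply: measurable_funB; apply: measurable_funM.
  - exact: measurable_sin_transform.
  - exact: measurable_cosM.
  - exact: measurable_cos_transform.
  - exact: measurable_sinM.
move=> z; rewrite (le_trans (ler_normB _ _))// lerD// normrM.
  by rewrite (le_trans _ (sin_transform_bounded z))// ler_piMr ?normr_cos.
by rewrite (le_trans _ (cos_transform_bounded z))// ler_piMr ?normr_sin.
Qed.

Lemma cos_transformN z : Ac (- z) = Ac z.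
Proof. by apply: eq_Rintegral => x _; rewrite mulNr cosN. Qed.

Lemma sin_transformN z : As (- z) = - As z.
Proof.
rewrite /sin_transform -[RHS]mulN1r -RintegralZl//; last exact: integrable_mul_sin.
by apply: eq_Rintegral => x _; rewrite mulNr sinN; ring.
Qed.

(** The substitution z -> -z shows that the integral equals its own negative. *)
Let Rintegral_G e u : 0 < e -> \int[mu]_z G e u z = 0.
Proof.
move=> e0; have N1 : (-1 : R) != 0 by rewrite oppr_eq0 oner_neq0.
have := Rintegral_affine 0 N1 (integrable_G u e0).
rewrite normrN1 invr1 mul1r.
have -> : \int[mu]_x G e u (-1 * x + 0) = \int[mu]_x (-1 * G e u x).
  apply: eq_Rintegral => x _; rewrite /G /K mulN1r addr0 normrN cos_transformN sin_transformN.
  by rewrite mulrN cosN sinN; ring.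
rewrite RintegralZl//; last exact: integrable_G.
by move=> h; lra.
Qed.

Variable S : R -> R -> R.
Hypothesis iS : mu2.-integrable setT (fun uv => (S uv.1 uv.2)%:E).

(** [p + i q] is the product of the values of [Ac + i As] at z and at w, and [H] is the real part of
    (p + i q) e^{-i phase}. *)
Let p (zw : R * R) := Ac zw.1 * Ac zw.2 - As zw.1 * As zw.2.
Let q (zw : R * R) := Ac zw.1 * As zw.2 + As zw.1 * Ac zw.2.
Let phase (uv zw : R * R) := zw.1 * uv.1 + zw.2 * uv.2.
Let H uv zw := p zw * cos (phase uv zw) + q zw * sin (phase uv zw).
Let KK e (zw : R * R) := K e zw.1 * K e zw.2.

Let integrable_KK e : 0 < e -> mu2.-integrable setT (EFin \o KK e).
Proof. by move=> e0; apply: integrable_tensor; exact: integrable_expR_abs. Qed.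

Let poisson_mean_mul e u v : 0 < e ->
  poisson_mean a e u * poisson_mean a e v = \int[mu2]_zw (H (u, v) zw * KK e zw).
Proof.
move=> e0.
transitivity (\int[mu2]_zw (F e u zw.1 * F e v zw.2 - G e u zw.1 * G e v zw.2)).
  rewrite RintegralB//; last 2 first.
  - by apply: integrable_tensor; exact: integrable_F.
  - by apply: integrable_tensor; exact: integrable_G.
  rewrite Rintegral_tensor ?integrable_F// Rintegral_tensor ?integrable_G//.
  by rewrite Rintegral_G// mul0r subr0.
apply: eq_Rintegral => -[z w] _; rewrite /H /p /q /phase /KK /F /G /= cosD sinD.
rewrite (mulrC u z) (mulrC v w); ring.
Qed.

Let measurable_p : measurable_fun setT p.
Proof.
have mA := measurable_cos_transform; have mB := measurable_sin_transform.
by apply: measurable_funB; apply: measurable_funM; exact: measurableT_comp.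
Qed.

Let measurable_q : measurable_fun setT q.
Proof.
have mA := measurable_cos_transform; have mB := measurable_sin_transform.
by apply: measurable_funD; apply: measurable_funM; exact: measurableT_comp.
Qed.

Let measurable_phase : measurable_fun setT (fun x : (R * R) * (R * R) => phase x.1 x.2).
Proof.
apply: measurable_funD; apply: measurable_funM.
- by apply: (measurableT_comp (f := fst)) => //; exact: measurable_snd.
- by apply: (measurableT_comp (f := fst)) => //; exact: measurable_fst.
- by apply: (measurableT_comp (f := snd)) => //; exact: measurable_snd.
- by apply: (measurableT_comp (f := snd)) => //; exact: measurable_fst.
Qed.

(** For integrals over (u, v) that depend on (z, w), the parameter has to stand first in the
    pair. *)
Let measurable_phase_swap : measurable_fun setT (fun x : (R * R) * (R * R) => phase x.2 x.1).
Proof.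
apply: measurable_funD; apply: measurable_funM.
- by apply: (measurableT_comp (f := fst)) => //; exact: measurable_fst.
- by apply: (measurableT_comp (f := fst)) => //; exact: measurable_snd.
- by apply: (measurableT_comp (f := snd)) => //; exact: measurable_fst.
- by apply: (measurableT_comp (f := snd)) => //; exact: measurable_snd.
Qed.

Let measurable_H : measurable_fun setT (fun x : (R * R) * (R * R) => H x.1 x.2).
Proof.
apply: measurable_funD; apply: measurable_funM.
- by apply: (measurableT_comp measurable_p); exact: measurable_snd.
- by apply: (measurableT_comp measurable_cos); exact: measurable_phase.
- by apply: (measurableT_comp measurable_q); exact: measurable_snd.
- by apply: (measurableT_comp measurable_sin); exact: measurable_phase.
Qed.

Let N0 : 0 <= N.
Proof. by apply: Rintegral_ge0. Qed.

Let H_bounded uv zw : `|H uv zw| <= 4 * N ^+ 2.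
Proof.
have mulB (x y : R) : `|x| <= N -> `|y| <= N -> `|x * y| <= N ^+ 2.
  by move=> xN yN; rewrite normrM expr2 ler_pM.
have h1 (x y : R) : `|x| <= 2 * N ^+ 2 -> `|y| <= 1 -> `|x * y| <= 2 * N ^+ 2.
  by move=> xN yN; rewrite normrM (le_trans _ xN)// ler_piMr.
have c1 := cos_transform_bounded; have s1 := sin_transform_bounded.
have pN : `|p zw| <= 2 * N ^+ 2.
  rewrite (le_trans (ler_normB _ _))//.
  have := mulB _ _ (c1 zw.1) (c1 zw.2); have := mulB _ _ (s1 zw.1) (s1 zw.2).
  by move=> ? ?; lra.
have qN : `|q zw| <= 2 * N ^+ 2.
  rewrite (le_trans (ler_normD _ _))//.
  have := mulB _ _ (c1 zw.1) (s1 zw.2); have := mulB _ _ (s1 zw.1) (c1 zw.2).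
  by move=> ? ?; lra.
rewrite (le_trans (ler_normD _ _))//.
have := h1 _ _ pN (normr_cos (phase uv zw)); have := h1 _ _ qN (normr_sin (phase uv zw)).
by move=> ? ?; lra.
Qed.

Let integrable_H_KK e uv : 0 < e -> mu2.-integrable setT (fun zw => (H uv zw * KK e zw)%:E).
Proof.
move=> e0; apply: integrable_bounded_mulRR.
- exact: (measurable_fun_pair2 uv measurable_H).
- exact: H_bounded.
- exact: integrable_KK.
Qed.

Let integrable_H_S zw : mu2.-integrable setT (fun uv => (H uv zw * S uv.1 uv.2)%:E).
Proof.
apply: integrable_bounded_mulRR.
- exact: (measurable_fun_pair1 zw measurable_H).
- by move=> uv; exact: H_bounded.
- exact: iS.
Qed.

Let integrable_H_S_KK e : 0 < e ->
  (sf2 \x sf2)%E.-integrable setT (fun x => (H x.1 x.2 * (S x.1.1 x.1.2 * KK e x.2))%:E).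
Proof.
move=> e0; have h2 := @integrable_bounded_mul_tensor _ _ _ _ _ sf2 sf2
  (fun x => H x.1 x.2) (fun uv => S uv.1 uv.2) (KK e) (4 * N ^+ 2) _ _ iS (integrable_KK e0).
apply: h2.
  exact: measurable_H.
by move=> x; exact: H_bounded.
Qed.

Let measurable_S_cos : measurable_fun setT (fun zw : R * R =>
  \int[mu2]_uv (S uv.1 uv.2 * cos (zw.1 * uv.1 + zw.2 * uv.2))).
Proof.
apply: (@measurable_Rintegral_param _ _ _ _ _ sf2
  (fun x : (R * R) * (R * R) => S x.2.1 x.2.2 * cos (x.1.1 * x.2.1 + x.1.2 * x.2.2))).
apply: measurable_funM.
  have mS := integrable_measurableRR iS.
  by apply: (measurableT_comp mS); exact: measurable_snd.
apply: (measurableT_comp measurable_cos).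
exact: measurable_phase_swap.
Qed.

Let measurable_S_sin : measurable_fun setT (fun zw : R * R =>
  \int[mu2]_uv (S uv.1 uv.2 * sin (zw.1 * uv.1 + zw.2 * uv.2))).
Proof.
apply: (@measurable_Rintegral_param _ _ _ _ _ sf2
  (fun x : (R * R) * (R * R) => S x.2.1 x.2.2 * sin (x.1.1 * x.2.1 + x.1.2 * x.2.2))).
apply: measurable_funM.
  have mS := integrable_measurableRR iS.
  by apply: (measurableT_comp mS); exact: measurable_snd.
apply: (measurableT_comp measurable_sin).
exact: measurable_phase_swap.
Qed.

Let integrable_S_cos z w :
  mu2.-integrable setT (fun uv => (S uv.1 uv.2 * cos (z * uv.1 + w * uv.2))%:E).
Proof.
under eq_fun do rewrite mulrC.
apply: integrable_bounded_mulRR; [|by move=> uv; exact: normr_cos|exact: iS].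
by apply: (measurableT_comp measurable_cos);
  exact: (measurable_fun_pair1 (z, w) measurable_phase).
Qed.

Let integrable_S_sin z w :
  mu2.-integrable setT (fun uv => (S uv.1 uv.2 * sin (z * uv.1 + w * uv.2))%:E).
Proof.
under eq_fun do rewrite mulrC.
apply: integrable_bounded_mulRR; [|by move=> uv; exact: normr_sin|exact: iS].
by apply: (measurableT_comp measurable_sin);
  exact: (measurable_fun_pair1 (z, w) measurable_phase).
Qed.

Let Im_fourier2N z w : complex.Im (fourier2 S z w) =
  - \int[mu2]_uv (S uv.1 uv.2 * sin (z * uv.1 + w * uv.2)).
Proof.
rewrite Im_fourier2 -[RHS]mulN1r -RintegralZl//.
  by apply: eq_Rintegral => uv _; rewrite mulN1r.
exact: integrable_S_sin.
Qed.

(** The real part of (p + i q) S^(z, w), which is what remains of [H] times the kernel once (u, v)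
    is integrated out. *)
Let Hhat zw := p zw * complex.Re (fourier2 S zw.1 zw.2) -
  q zw * complex.Im (fourier2 S zw.1 zw.2).

Let Rintegral_H_S zw : \int[mu2]_uv (H uv zw * S uv.1 uv.2) = Hhat zw.
Proof.
rewrite /Hhat Re_fourier2 Im_fourier2N mulrN opprK.
rewrite -RintegralZl//; last exact: integrable_S_cos.
rewrite -RintegralZl//; last exact: integrable_S_sin.
rewrite -RintegralD//; last 2 first.
- have := integrableZl measurableT (p zw) (integrable_S_cos zw.1 zw.2).
  by apply: eq_integrable => // x _; rewrite /= EFinM.
- have := integrableZl measurableT (q zw) (integrable_S_sin zw.1 zw.2).
  by apply: eq_integrable => // x _; rewrite /= EFinM.
by apply: eq_Rintegral => uv _; rewrite /H /phase; ring.
Qed.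

(** Fubini applies on R^2 x R^2 because [H] is bounded and multiplies the integrable tensor product
    of [S] and [KK]; the damping [KK] stands in for integrability of the transforms. *)
Lemma parseval_poisson e : 0 < e ->
  \int[mu2]_uv (S uv.1 uv.2 * (poisson_mean a e uv.1 * poisson_mean a e uv.2)) =
  \int[mu2]_zw (KK e zw * Hhat zw).
Proof.
move=> e0.
pose f (x : (R * R) * (R * R)) := H x.1 x.2 * (S x.1.1 x.1.2 * KK e x.2).
transitivity (\int[mu2]_uv \int[mu2]_zw f (uv, zw)).
  apply: eq_Rintegral => -[u v] _; rewrite poisson_mean_mul// -RintegralZl//.
    by apply: eq_Rintegral => zw _; rewrite /f /=; ring.
  exact: integrable_H_KK.
rewrite (@Rintegral_fubini _ _ _ _ _ sf2 sf2 f).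
- apply: eq_Rintegral => zw _; rewrite -Rintegral_H_S -RintegralZl//.
    by apply: eq_Rintegral => uv _; rewrite /f /=; ring.
  exact: integrable_H_S.
- exact: integrable_H_S_KK.
- move=> uv; have := integrableZl measurableT (S uv.1 uv.2) (integrable_H_KK uv e0).
  by apply: eq_integrable => // zw _; rewrite /= -EFinM; congr EFin; rewrite /f/=; ring.
- move=> zw; have := integrableZl measurableT (KK e zw) (integrable_H_S zw).
  by apply: eq_integrable => // uv _; rewrite /= -EFinM; congr EFin; rewrite /f/=; ring.
Qed.

Variables (W : R -> R) (M : R).
Hypothesis mW : measurable_fun setT W.
Hypothesis AW : forall z, Num.sqrt (Ac z ^+ 2 + As z ^+ 2) <= W z.
Hypothesis SWM : (\int[mu2]_zw
  (cabs (fourier2 S zw.1 zw.2) * W zw.1 * W zw.2)%:E <= M%:E)%E.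

Let Hhat_le zw : `|Hhat zw| <= cabs (fourier2 S zw.1 zw.2) * W zw.1 * W zw.2.
Proof.
rewrite normc_ReIm; set x := complex.Re _; set y := complex.Im _.
have sq0 (b c : R) : 0 <= b ^+ 2 + c ^+ 2 by rewrite addr_ge0 ?sqr_ge0.
apply: (@le_trans _ _ (Num.sqrt (x ^+ 2 + y ^+ 2) * (Num.sqrt (Ac zw.1 ^+ 2 + As zw.1 ^+ 2) *
   Num.sqrt (Ac zw.2 ^+ 2 + As zw.2 ^+ 2)))); last first.
  by rewrite -mulrA ler_wpM2l ?sqrtr_ge0// ler_pM ?sqrtr_ge0.
rewrite -!sqrtrM ?mulr_ge0// -sqrtr_sqr ler_sqrt ?mulr_ge0// -subr_ge0.
rewrite /Hhat /p /q -/x -/y.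
(* The squared product of the moduli minus the squared real part is the squared imaginary part. *)
have -> : forall A1 A2 B1 B2 : R, (x ^+ 2 + y ^+ 2) * ((A1 ^+ 2 + B1 ^+ 2) * (A2 ^+ 2 +
  B2 ^+ 2)) -
  ((A1 * A2 - B1 * B2) * x - (A1 * B2 + B1 * A2) * y) ^+ 2 =
  ((A1 * A2 - B1 * B2) * y + (A1 * B2 + B1 * A2) * x) ^+ 2 by move=> *; ring.
exact: sqr_ge0.
Qed.

Let measurable_Hhat : measurable_fun setT Hhat.
Proof.
rewrite /Hhat; apply: measurable_funB; apply: measurable_funM => //.
  by under eq_fun do rewrite Re_fourier2; exact: measurable_S_cos.
by under eq_fun do rewrite Im_fourier2N; apply: measurable_funN; exact: measurable_S_sin.
Qed.

Lemma measurable_cabs_fourier2 : measurable_fun setT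
  (fun zw : R * R => cabs (fourier2 S zw.1 zw.2)).
Proof.
under eq_fun do rewrite normc_ReIm.
apply: (measurableT_comp (f := @Num.sqrt R)).
  by apply: continuous_measurable_fun; exact: sqrt_continuous.
by apply: measurable_funD; apply: measurable_funX;
  [under eq_fun do rewrite Re_fourier2; exact: measurable_S_cos|
   under eq_fun do rewrite Im_fourier2N; apply: measurable_funN; exact: measurable_S_sin].
Qed.

(** The damping lies between 0 and 1, so discarding it leaves a bound independent of [e]; [SWM] also
    supplies the integrability of the right-hand side. *)
Lemma parseval_poisson_le e : 0 < e ->
  `|\int[mu2]_uv (S uv.1 uv.2 * (poisson_mean a e uv.1 * poisson_mean a e uv.2))| <= M.
Proof.
move=> e0; rewrite parseval_poisson//.
have mKH : measurable_fun setT (fun zw => KK e zw * Hhat zw).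
  apply: measurable_funM => //.
  exact: (integrable_measurableRR (integrable_KK e0)).
have KH zw : `|KK e zw * Hhat zw| <= cabs (fourier2 S zw.1 zw.2) * W zw.1 * W zw.2.
  apply: le_trans (Hhat_le zw); rewrite normrM ler_piMl//.
  have K1 z : 0 <= K e z <= 1 by rewrite expR_ge0 -expR0 ler_expR oppr_le0 mulr_ge0// ltW.
  have /andP[K0 K1'] := K1 zw.1; have /andP[K2 K3] := K1 zw.2.
  by rewrite /KK ger0_norm ?mulr_ge0// mulr_ile1.
have hKH : (\int[mu2]_zw (`|KK e zw * Hhat zw|)%:E <= M%:E)%E.
  apply: le_trans SWM; apply: ge0_le_integral => //.
  - by apply/measurable_EFinP; exact: measurableT_comp.
  - apply/measurable_EFinP; apply: measurable_funM; last exact: measurableT_comp.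
    by apply: measurable_funM; [exact: measurable_cabs_fourier2|exact: measurableT_comp].
  - by move=> zw _; rewrite lee_fin.
have ii : mu2.-integrable setT (fun zw => (KK e zw * Hhat zw)%:E).
  apply/integrableP; split; first exact/measurable_EFinP.
  by rewrite (le_lt_trans hKH)// ltry.
rewrite (le_trans (le_normr_Rintegral _ ii))//.
by rewrite -lee_fin /Rintegral fineK// integrable_fin_num// integrable_norm.
Qed.

Let measurable_poisson_mean e : measurable_fun setT (poisson_mean a e).
Proof.
apply: (@measurable_Rintegral_param _ _ _ _ _ mu (fun uz : R * R => K e uz.2 *
  (Ac uz.2 * cos (uz.1 * uz.2) + As uz.2 * sin (uz.1 * uz.2)))).
have mp : measurable_fun setT (fun uz : R * R => uz.1 * uz.2) by exact: measurable_funM.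
apply: measurable_funM; first by apply: (measurableT_comp (measurable_K e)).
apply: measurable_funD; apply: measurable_funM.
- exact: (measurableT_comp measurable_cos_transform).
- exact: (measurableT_comp measurable_cos).
- exact: (measurableT_comp measurable_sin_transform).
- exact: (measurableT_comp measurable_sin).
Qed.

Lemma integrable_kernel_mul : mu2.-integrable setT
  (fun uv => (S uv.1 uv.2 * (a uv.1 * a uv.2))%:E).
Proof.
have ma : measurable_fun setT a by exact: continuous_measurable_fun.
under eq_fun do rewrite mulrC.
apply: (@integrable_bounded_mulRR _ _ _ (B ^+ 2)) iS.
  by apply: measurable_funM; exact: (measurableT_comp ma).
by move=> uv; rewrite normrM expr2 ler_pM.
Qed.

(* Dominated convergence as the width [1/n] of the Poisson kernel tends to 0. *)
Lemma parseval_le :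
  `|\int[mu2]_uv (S uv.1 uv.2 * (a uv.1 * a uv.2))| <= M / (2 * pi) ^+ 2.
Proof.
pose D n := \int[mu2]_uv (S uv.1 uv.2 *
  (poisson_mean a n.+1%:R^-1 uv.1 * poisson_mean a n.+1%:R^-1 uv.2)).
have DM n : `|D n| <= M by apply: parseval_poisson_le; rewrite invr_gt0.
have pi20 : 0 < (2 * pi : R) ^+ 2 by rewrite exprn_gt0// mulr_gt0 ?pi_gt0.
have B0 : 0 <= B by exact: le_trans (aB 0).
have mS := integrable_measurableRR iS.
(* Each unnormalised mean tends to 2 pi a(u), hence the factor (2 pi)^2. *)
suff cD : D n @[n --> \oo] --> (2 * pi) ^+ 2 * \int[mu2]_uv (S uv.1 uv.2 * (a uv.1 * a uv.2)).
  rewrite ler_pdivlMr// mulrC -(gtr0_norm pi20) -normrM.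
  move/cvg_norm : cD => cN; rewrite -(cvg_lim _ cN)//.
  apply: limr_le; first by apply/cvg_ex; eexists; exact: cN.
  exact: nearW.
rewrite -RintegralZl//; last exact: integrable_kernel_mul.
apply: (@cvg_Rintegral_dominatedRR _ _ _ (fun uv => `|S uv.1 uv.2| * (2 * (B * pi)) ^+ 2)).
- move=> n; apply: measurable_funM => //.
  by apply: measurable_funM; exact: (measurableT_comp (measurable_poisson_mean _)).
- move=> uv.
  rewrite (_ : _ * (_ * _) = S uv.1 uv.2 * ((2 * (a uv.1 * pi)) * (2 * (a uv.2 * pi))));
    last by ring.
  apply: cvgM; first exact: cvg_cst.
  have cp u : poisson_mean a n.+1%:R^-1 u @[n --> \oo] --> 2 * (a u * pi).
    exact: (cvg_poisson_mean ca aB).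
  by apply: cvgM.
- have := integrableZr measurableT ((2 * (B * pi)) ^+ 2) (integrable_norm iS).
  by apply: eq_integrable => // x _; rewrite /= EFinM.
- move=> n uv; rewrite normrM ler_wpM2l// normrM expr2.
  by rewrite ler_pM// poisson_mean_bounded// invr_gt0.
Qed.
End parseval_bound.

(** * Riemann sums of double integrals *)

Section riemann_sums.
Context {R : realType}.
Local Notation mu := (@lebesgue_measure R).
Local Notation mu2 := (mu \x mu)%E.

Definition grid (al D : R) (i : nat) : R := al + i%:R * D.

Lemma gridS al D i : grid al D i.+1 = grid al D i + D.
Proof. by rewrite /grid -natr1; ring. Qed.

Lemma grid_le al D i j : 0 <= D -> (i <= j)%N -> grid al D i <= grid al D j.
Proof. by move=> D0 ij; rewrite /grid lerD2l ler_wpM2r// ler_nat. Qed.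

(** Induction on the number of cells: the sum samples left endpoints, so each cell contributes at
    most [eta * D]. *)
Lemma riemann_sum_dist (h : R -> R) (al D eta : R) (n : nat) : 0 <= D ->
  mu.-integrable `[al, grid al D n] (EFin \o h) ->
  (forall i u, (i < n)%N -> grid al D i <= u <= grid al D i.+1 ->
     `|h (grid al D i) - h u| <= eta) ->
  `|\sum_(i < n) D * h (grid al D i) - \int[mu]_(u in `[al, grid al D n]) h u| <=
  eta * (n%:R * D).
Proof.
move=> D0; elim: n => [|n IH] ih osc.
  by rewrite big_ord0 /grid !mul0r addr0 set_itv1 Rintegral_set1 subr0 normr0 mulr0.
have gn : al <= grid al D n by rewrite /grid lerDl mulr_ge0.
have gS : grid al D n <= grid al D n.+1 by exact: grid_le.
have ih1 : mu.-integrable `[al, grid al D n] (EFin \o h).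
  by apply: integrableS ih => //; apply: subset_itvl; rewrite bnd_simp.
have ih2 : mu.-integrable `]grid al D n, grid al D n.+1] (EFin \o h).
  by apply: integrableS ih => //; apply: subset_itvr; rewrite bnd_simp.
have {}IH := IH ih1 (fun i u lin => osc i u (ltnW lin)).
have split : \int[mu]_(u in `[al, grid al D n.+1]) h u =
    \int[mu]_(u in `[al, grid al D n]) h u + \int[mu]_(u in `]grid al D n, grid al D n.+1]) h u.
  by rewrite -(@Rintegral_itvB _ _ _ _ (grid al D n) ih) ?bnd_simp//; ring.
have muI : fine (mu `]grid al D n, grid al D n.+1]) = D.
  rewrite lebesgue_measure_itv/= lte_fin gridS ltrDl.
  have [_|D1] := ltP 0 D; first by rewrite /= addrAC subrr add0r.
  by apply/esym/eqP; rewrite eq_le D0 D1.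
have icst (c : R) : mu.-integrable `]grid al D n, grid al D n.+1] (fun=> c%:E).
  have hc : mu.-integrable `[grid al D n, grid al D n.+1] (EFin \o cst c).
    apply: continuous_compact_integrable; first exact: segment_compact.
    by apply: continuous_subspaceT => x; exact: cvg_cst.
  by apply: integrableS hc => //; apply: subset_itvr; rewrite bnd_simp.
have last_cell : `|D * h (grid al D n) - \int[mu]_(u in `]grid al D n,
  grid al D n.+1]) h u| <= eta * D.
  have -> : D * h (grid al D n) = \int[mu]_(u in `]grid al D n, grid al D n.+1]) h (grid al D n).
    by rewrite Rintegral_cst// muI mulrC.
  rewrite -RintegralB//; last exact: icst.
  have ii : mu.-integrable `]grid al D n, grid al D n.+1]
      (EFin \o (fun u => h (grid al D n) - h u)).
    by apply: (integrableB _ (icst (h (grid al D n))) ih2).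
  rewrite (le_trans (le_normr_Rintegral _ ii))//.
  have -> : eta * D = \int[mu]_(u in `]grid al D n, grid al D n.+1]) eta.
    by rewrite Rintegral_cst// muI.
  apply: le_Rintegral => //; [exact: integrable_norm|exact: icst|].
  move=> u /=; rewrite in_itv/= => /andP[u1 u2].
  by apply: osc => //; rewrite (ltW u1).
rewrite big_ord_recr/= split opprD addrACA (le_trans (ler_normD _ _))//.
by rewrite -natr1 mulrDl mulrDr mul1r lerD.
Qed.

(** Heine's theorem, with compactness used in covering form: a property that holds near each point
    for all small delta holds on the whole square for one delta. *)
Lemma square_unif_continuous (f : R * R -> R) (al be eta : R) : continuous f -> 0 < eta ->
  exists2 delta : R, 0 < delta & forall u v u' v',
    al <= u <= be -> al <= v <= be -> `|u - u'| < delta -> `|v - v'| < delta ->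
    `|f (u, v) - f (u', v')| < eta.
Proof.
move=> cf eta0.
have cK : compact (`[al, be] `*` `[al, be] : set (R * R)).
  by apply: compact_setX; exact: segment_compact.
have /compact_near_coveringP/(_ R (0^'+ : set_system R) (fun delta uv => forall u' v',
  `|uv.1 - u'| < delta -> `|uv.2 - v'| < delta -> `|f uv - f (u', v')| < eta) _) := cK.
case=> [[u v] _|d /= d0 Hd].
  have /cvgrPdist_lt /(_ (eta / 2)) := cf (u, v).
  move=> /(_ (divr_gt0 eta0 (ltr0n _ 2))) [[U V] /= [[r r0 Ur] [s s0 Vs]] UV].
  (* Half radii: a point within delta of (x, y), itself in the half-size box, stays in the full
     neighbourhood of (u, v). *)
  exists (ball u (r / 2) `*` ball v (s / 2), `]0, Num.min (r / 2) (s / 2)[%classic) => /=.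
    split; first by exists (ball u (r / 2), ball v (s / 2)) => //=; split; apply: nbhsx_ballx;
      rewrite divr_gt0.
    exists (Num.min (r / 2) (s / 2)); first by rewrite /= lt_min !divr_gt0.
    by move=> y /= + y0; rewrite sub0r normrN gtr0_norm// in_itv/= y0.
  move=> [[x y] dl] /= [[ux vy]]; rewrite in_itv/= => /andP[_].
  rewrite lt_min => /andP[dr ds] u' v' xu yv.
  rewrite (_ : f _ - f _ = (f (u, v) - f (u', v')) - (f (u, v) - f (x, y))); last by ring.
  rewrite (le_lt_trans (ler_normB _ _))// (splitr eta) ltrD//.
    apply: (UV (u', v')); split => /=; [apply: Ur|apply: Vs].
      have xu' : ball x (r / 2) u' by rewrite /ball/= (lt_trans xu).
      by have := ball_triangle ux xu'; rewrite -splitr.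
    have yv' : ball y (s / 2) v' by rewrite /ball/= (lt_trans yv).
    by have := ball_triangle vy yv'; rewrite -splitr.
  apply: (UV (x, y)); split => /=; [apply: Ur|apply: Vs].
    by apply: le_ball ux; rewrite ler_piMr// ?ltW// invf_lt1// ltr1n.
  by apply: le_ball vy; rewrite ler_piMr// ?ltW// invf_lt1// ltr1n.
exists (d / 2); first by rewrite divr_gt0.
move=> u v u' v' uK vK uu vv.
have d2 : 0 < d / 2 by rewrite divr_gt0.
apply: (Hd (d / 2) _ d2 (u, v)) => //=.
  by rewrite sub0r normrN gtr0_norm// ltr_pdivrMr// ltr_pMr// ltr1n.
Qed.

Lemma Rintegral_indic_mul (K : set R) (h : R -> R) :
  \int[mu]_u (\1_K u * h u) = \int[mu]_(u in K) h u.
Proof.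
rewrite [RHS]Rintegral_mkcond; apply: eq_Rintegral => u _.
by rewrite patchE indicE; case: ifP => uK; rewrite ?uK ?(mul1r, mul0r).
Qed.

Lemma integrable_indic_mul (K : set R) (h : R -> R) : measurable K ->
  mu.-integrable K (EFin \o h) <-> mu.-integrable setT (fun u => (\1_K u * h u)%:E).
Proof.
move=> mK; have E : (EFin \o h) \_ K = (fun u => (\1_K u * h u)%:E).
  by apply/funext => u; rewrite patchE indicE; case: ifP => uK; rewrite ?uK ?(mul1r, mul0r).
by rewrite -E; exact: integrable_mkcond.
Qed.

Definition square_indic (K : set R) (uv : R * R) : R := \1_K uv.1 * \1_K uv.2.

Lemma measurable_square_indic (K : set R) : measurable K -> measurable_fun setT (square_indic K).
Proof.
move=> mK; have m1 : measurable_fun setT (\1_K : R -> R) by exact: measurable_indic.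
by apply: measurable_funM; exact: (measurableT_comp m1).
Qed.

Lemma square_indic_le1 (K : set R) uv : `|square_indic K uv| <= 1.
Proof.
by rewrite /square_indic !indicE ger0_norm ?mulr_ge0 ?ler0n// mulr_ile1 ?ler0n ?lern1 ?leq_b1.
Qed.

(** Mean-square integrability controls every partition of small mesh, so one uniform grid finer than
    [delta] and accurate to [eta] is enough. The double sum is compared first with a sum of inner
    integrals, then with the iterated integral. *)
Lemma double_riemann_sum (f : R * R -> R) (al be delta eta : R) : continuous f ->
  mu2.-integrable setT (EFin \o f) -> al < be -> 0 < delta -> 0 < eta ->
  exists n, let D := (be - al) / n.+1%:R in
    [/\ 0 < D < delta, grid al D n.+1 = be &
    `|\sum_(i < n.+1) \sum_(j < n.+1) (D * D * f (grid al D i, grid al D j)) -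
      \int[mu2]_uv (square_indic `[al, be] uv * f uv)| <= eta].
Proof.
move=> cf fi albe delta0 eta0; set K := `[al, be]%classic.
have L0 : 0 < be - al by rewrite subr_gt0.
(* The inner and the outer comparison each cost e1 (be - al)^2, that is eta / 2. *)
pose e1 := eta / (2 * (be - al) ^+ 2).
have e10 : 0 < e1 by rewrite divr_gt0// mulr_gt0// exprn_gt0.
have [del1 del10 osc] := square_unif_continuous al be cf e10.
pose del := Num.min delta del1.
have del0 : 0 < del by rewrite lt_min delta0.
(* Then n + 1 exceeds (be - al) / del, which brings the mesh below [del]. *)
pose n := Num.truncn ((be - al) / del).
exists n => D.
have D0 : 0 < D by rewrite divr_gt0.
have Ddel : D < del.
  by rewrite ltr_pdivrMr// mulrC -ltr_pdivrMr// Num.Theory.truncnS_gt.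
have /andP[Ddelta Ddel1] : (D < delta) && (D < del1) by rewrite -lt_min.
have gE : grid al D n.+1 = be.
  by rewrite /grid mulrC divfK ?pnatr_eq0// addrC subrK.
split; [by rewrite D0|exact: gE|].
have DE : n.+1%:R * D = be - al by rewrite mulrC divfK ?pnatr_eq0.
have gK i : (i <= n.+1)%N -> al <= grid al D i <= be.
  move=> ile; have := grid_le al (ltW D0) ile; rewrite gE => ->; rewrite andbT.
  by rewrite /grid lerDl mulr_ge0// ltW.
have cellK i u : (i < n.+1)%N -> grid al D i <= u <= grid al D i.+1 ->
   (al <= u <= be) /\ `|grid al D i - u| < del1.
  move=> ile /andP[u1 u2]; have /andP[g1 _] := gK _ (ltnW ile); have /andP[_ g2] := gK _ ile.
  rewrite (le_trans g1 u1) (le_trans u2 g2); split => //.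
  rewrite distrC ger0_norm ?subr_ge0// (le_lt_trans _ Ddel1)// lerBlDl -gridS.
  exact: u2.
pose H u := \int[mu]_(v in K) f (u, v).
have mK : measurable K by exact: measurable_itv.
have fuK u : mu.-integrable K (fun v => (f (u, v))%:E).
  apply: continuous_compact_integrable; first exact: segment_compact.
  apply: continuous_subspaceT => v; apply: (cvg_comp _ f); last exact: cf.
  by apply: (@cvg_pair _ _ _ _ (nbhs u) (nbhs v)); [exact: cvg_cst|exact: cvg_id].
pose F uv := square_indic K uv * f uv.
have iF : mu2.-integrable setT (EFin \o F).
  apply: integrable_bounded_mulRR fi; first exact: measurable_square_indic.
  exact: square_indic_le1.
have iFu u : mu.-integrable setT (fun v => (F (u, v))%:E).
  have /(integrable_indic_mul _ mK) h := fuK u.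
  have := integrableZl measurableT (\1_K u) h.
  by apply: eq_integrable => // v _; rewrite /= -EFinM mulrA.
have FH u : \int[mu]_v F (u, v) = \1_K u * H u.
  rewrite /H -(Rintegral_indic_mul K) -RintegralZl//.
    by apply: eq_Rintegral => v _; rewrite mulrA.
  by have /(integrable_indic_mul _ mK) := fuK u.
have iH : mu.-integrable K (EFin \o H).
  apply/(integrable_indic_mul _ mK).
  have := integrable_Rintegral iF iFu.
  by apply: eq_integrable => // u _; rewrite /= FH.
have -> : \int[mu2]_uv F uv = \int[mu]_(u in K) H u.
  rewrite (Rintegral_product iF iFu) -(Rintegral_indic_mul K).
  by apply: eq_Rintegral => u _; rewrite FH.
have muK : fine (mu K) = be - al by rewrite /K lebesgue_measure_itv/= lte_fin albe.
have inner i : (i < n.+1)%N ->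
    `|\sum_(j < n.+1) D * f (grid al D i, grid al D j) - H (grid al D i)| <= e1 * (be - al).
  move=> ile; rewrite -DE /H /K -{1}gE.
  apply: (@riemann_sum_dist (fun v => f (grid al D i, v))); [exact: ltW|rewrite gE; exact: fuK|].
  move=> j v jle jv; have [vK jvd] := cellK j v jle jv.
  have /andP[g1 g2] := gK _ (ltnW ile); have /andP[g3 g4] := gK _ (ltnW jle).
  by apply: ltW; apply: osc => //; rewrite ?g1 ?g3// subrr normr0.
have outer : `|\sum_(i < n.+1) D * H (grid al D i) - \int[mu]_(u in K) H u| <=
    e1 * (be - al) * (be - al).
  rewrite -{2}DE /K -{1}gE.
  apply: riemann_sum_dist; [exact: ltW|rewrite gE; exact: iH|].
  move=> i u ile iu; have [uK iud] := cellK i u ile iu.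
  have /andP[g1 g2] := gK _ (ltnW ile).
  rewrite /H -RintegralB//; [|exact: fuK|exact: fuK].
  have ii : mu.-integrable K (EFin \o (fun v => f (grid al D i, v) - f (u, v))).
    by apply: (integrableB _ (fuK (grid al D i)) (fuK u)).
  rewrite (le_trans (le_normr_Rintegral _ ii))//.
  rewrite -muK -Rintegral_cst//; apply: le_Rintegral => //.
  - exact: integrable_norm.
  - apply: continuous_compact_integrable; first exact: segment_compact.
    by apply: continuous_subspaceT => x; exact: cvg_cst.
  - move=> v; rewrite /K/= in_itv/= => vK; apply: ltW; apply: osc => //; first by rewrite g1.
    by rewrite subrr normr0.
have -> : \sum_(i < n.+1) \sum_(j < n.+1) (D * D * f (grid al D i, grid al D j)) =
    \sum_(i < n.+1) D * (\sum_(j < n.+1) D * f (grid al D i, grid al D j)).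
  by apply: eq_bigr => i _; rewrite mulr_sumr; apply: eq_bigr => j _; rewrite mulrA.
rewrite -(subrKA (\sum_(i < n.+1) D * H (grid al D i))) (le_trans (ler_normD _ _))//.
have -> : eta = e1 * (be - al) * (be - al) + e1 * (be - al) * (be - al).
  by rewrite /e1; field; rewrite gt_eqF.
apply: lerD => //; rewrite -sumrB (le_trans (ler_norm_sum _ _ _))//.
have -> : e1 * (be - al) * (be - al) = \sum_(i < n.+1) D * (e1 * (be - al)).
  by rewrite sumr_const card_ord -[in RHS]mulr_natl mulrA DE; ring.
by apply: ler_sum => i _; rewrite -mulrBr normrM (gtr0_norm D0) ler_wpM2l ?(ltW D0)// inner.
Qed.

Lemma cvg_square_integral (f : R * R -> R) : mu2.-integrable setT (EFin \o f) ->
  \int[mu2]_uv (square_indic `[- n%:R, n%:R] uv * f uv) @[n --> \oo] --> \int[mu2]_uv f uv.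
Proof.
move=> fi; have mf := integrable_measurableRR fi.
apply: (cvg_Rintegral_dominatedRR (g := fun uv => `|f uv|)).
- by move=> n; apply: measurable_funM => //; exact: measurable_square_indic.
- move=> [u v]; rewrite -[X in _ --> X]mul1r; apply: cvgMl.
  apply: cvg_near_cst; near=> n.
  have un : `|u| <= n%:R by near: n; exact: nbhs_infty_ger.
  have vn : `|v| <= n%:R by near: n; exact: nbhs_infty_ger.
  by rewrite /square_indic !indicE/= !mem_set ?mulr1//= in_itv/= -ler_norml.
- exact: integrable_norm.
- by move=> n uv; rewrite normrM ler_piMl// square_indic_le1.
Unshelve. all: by end_near. Qed.

End riemann_sums.

(** * Second moments of mean-square integrals *)

Section second_order_process.
Context d (Omega : measurableType d) (R : realType) (P : probability Omega R).
Variable X : R -> {RV P >-> R}.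
Hypothesis Xsq : forall t, ('E_P[fun w => (X t w ^+ 2)%R] < +oo)%E.

Let integrable_sq t : P.-integrable setT (fun w => (X t w ^+ 2)%:E).
Proof.
apply/integrableP; split; first by apply/measurable_EFinP; exact: measurable_funX.
have := Xsq t; rewrite expectation.unlock; apply: le_lt_trans.
by apply: ge0_le_integral => //= [||w _];
  [apply/measurable_EFinP; apply: measurableT_comp => //; exact: measurable_funX|
   by apply/measurable_EFinP; exact: measurable_funX|rewrite ger0_norm ?sqr_ge0].
Qed.

Let integrable_prod t s : P.-integrable setT (fun w => (X t w * X s w)%:E).
Proof.
apply: (@integrable_dominated _ _ _ P _ (fun w => X t w ^+ 2 + X s w ^+ 2)).
- exact: measurable_funM.
- have := integrableD measurableT (integrable_sq t) (integrable_sq s).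
  by apply: eq_integrable => // w _; rewrite /= EFinD.
- move=> w; rewrite normrM -(real_normK (num_real (X t w))) -(real_normK (num_real (X s w))).
  rewrite -subr_ge0; set x := `|_|; set y := `|_|.
  have -> : x ^+ 2 + y ^+ 2 - x * y = (x - y) ^+ 2 / 2 + (x ^+ 2 + y ^+ 2) / 2 by field.
  by rewrite addr_ge0// divr_ge0// ?addr_ge0 ?sqr_ge0.
Qed.

Lemma expectation_lin_sq n (c s : nat -> R) :
  'E_P[fun w => ((\sum_(i < n) c i * X (s i) w) ^+ 2)%R]%E =
  (\sum_(i < n) \sum_(j < n) c i * c j * covfun X (s i) (s j))%:E.
Proof.
rewrite expectation.unlock.
transitivity (\int[P]_w (\sum_(i < n) \sum_(j < n) (c i * c j)%:E *
    (X (s i) w * X (s j) w)%:E))%E.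
  apply: eq_integral => w _; rewrite expr2 mulr_suml -sumEFin; apply: eq_bigr => i _.
  rewrite mulr_sumr -sumEFin; apply: eq_bigr => j _.
  by rewrite -EFinM; congr EFin; ring.
have covE t r : (\int[P]_w (X t w * X r w)%:E = (covfun X t r)%:E)%E.
  by rewrite /covfun expectation.unlock fineK// integrable_fin_num.
have iij i j : P.-integrable setT (fun w => (c i * c j)%:E * (X (s i) w * X (s j) w)%:E)%E.
  exact: integrableZl.
rewrite integral_sum//; last by move=> i; exact: integrable_sum.
rewrite -sumEFin; apply: eq_bigr => i _.
rewrite integral_sum//.
rewrite -sumEFin; apply: eq_bigr => j _.
by rewrite integralZl// covE -EFinM.
Qed.

Lemma sqnorm2E (Y : Omega -> R[i]) : sqnorm2 P Y =
  (\int[P]_w (complex.Re (Y w) ^+ 2 + complex.Im (Y w) ^+ 2)%:E)%E.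
Proof.
rewrite /sqnorm2 expectation.unlock; apply: eq_integral => w _; congr EFin.
by case: (Y w) => x y /=; rewrite sqr_sqrtr// addr_ge0 ?sqr_ge0.
Qed.

Lemma cmeasurableB (Y Z : Omega -> R[i]) : cmeasurable setT Y -> cmeasurable setT Z ->
  cmeasurable setT (fun w => Y w - Z w).
Proof.
move=> [rY iY] [rZ iZ]; split.
  by under eq_fun do rewrite raddfB /=; exact: measurable_funB.
by under eq_fun do rewrite raddfB /=; exact: measurable_funB.
Qed.

Lemma measurable_normsq (Y : Omega -> R[i]) : cmeasurable setT Y ->
  measurable_fun setT (fun w => (complex.Re (Y w) ^+ 2 + complex.Im (Y w) ^+ 2)%:E).
Proof.
by move=> [rY iY]; apply/measurable_EFinP; apply: measurable_funD; exact: measurable_funX.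
Qed.

(** A substitute for the triangle inequality in L^2: it holds pointwise before integration, so
    infinite norms are allowed. *)
Lemma sqnorm2_le (Y Z : Omega -> R[i]) : cmeasurable setT Y -> cmeasurable setT Z ->
  (sqnorm2 P Y <= 2%:E * sqnorm2 P (fun w => (Y w - Z w)%R) + 2%:E * sqnorm2 P Z)%E.
Proof.
move=> mY mZ; have mYZ := cmeasurableB mY mZ.
have sq0 (x y : R) : (0 <= (x ^+ 2 + y ^+ 2)%:E)%E by rewrite lee_fin addr_ge0 ?sqr_ge0.
rewrite !sqnorm2E -!ge0_integralZl//; try exact: measurable_normsq.
have mZl (c : R) V : cmeasurable setT V -> measurable_fun setT
    (fun w => c%:E * (complex.Re (V w) ^+ 2 + complex.Im (V w) ^+ 2)%:E)%E.
  move=> [rV iV]; under eq_fun do rewrite -EFinM.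
  apply/measurable_EFinP; apply: measurable_funM => //.
  by apply: measurable_funD; exact: measurable_funX.
rewrite -ge0_integralD//; try exact: mZl; try by move=> w _; rewrite mule_ge0.
apply: ge0_le_integral => //.
- exact: measurable_normsq.
- by apply: emeasurable_funD; exact: mZl.
move=> w _; rewrite -!EFinM -EFinD lee_fin !raddfB /=.
set x := complex.Re (Y w); set y := complex.Im (Y w).
set x' := complex.Re (Z w); set y' := complex.Im (Z w); rewrite -subr_ge0.
(* 2|Y - Z|^2 + 2|Z|^2 - |Y|^2 = |Y - 2Z|^2. *)
rewrite (_ : _ - _ = (x - 2 * x') ^+ 2 + (y - 2 * y') ^+ 2); last by ring.
by rewrite addr_ge0 ?sqr_ge0.
Qed.

Variable g : R -> R[i].
Local Notation a := (fun u => complex.Re (g u)).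
Local Notation b := (fun u => complex.Im (g u)).

Let Rsum n (D s : nat -> R) w : R[i] :=
  \sum_(i < n) (D i)%:C * ((X (s i) w)%:C * conjc (g (s i))).

Let Re_Rsum n D s w : complex.Re (Rsum n D s w) = \sum_(i < n) (D i * a (s i)) * X (s i) w.
Proof.
rewrite /Rsum raddf_sum; apply: eq_bigr => i _.
by case: (g (s i)) => x y /=; ring.
Qed.

Let Im_Rsum n D s w : complex.Im (Rsum n D s w) = \sum_(i < n) (- (D i * b (s i))) * X (s i) w.
Proof.
rewrite /Rsum raddf_sum; apply: eq_bigr => i _.
by case: (g (s i)) => x y /=; ring.
Qed.

Let cmeasurable_Rsum n D s : cmeasurable setT (Rsum n D s).
Proof.
split.
  by under eq_fun do rewrite Re_Rsum; apply: measurable_sum => i; exact: measurable_funM.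
by under eq_fun do rewrite Im_Rsum; apply: measurable_sum => i; exact: measurable_funM.
Qed.

(* The real part of [R(u,v) g(u) conj(g(v))]; its imaginary part is antisymmetric. *)
Definition kernel_product (uv : R * R) : R :=
  covfun X uv.1 uv.2 * (a uv.1 * a uv.2 + b uv.1 * b uv.2).

(** Real and imaginary parts of the sum are real linear combinations of the [X (s i)], with weights
    from Re g and -Im g; their second moments add up to [kernel_product]. *)
Let sqnorm2_Rsum n D s : sqnorm2 P (Rsum n D s) =
  (\sum_(i < n) \sum_(j < n) D i * D j * kernel_product (s i, s j))%:E.
Proof.
have mS c : measurable_fun setT (fun w => \sum_(i < n) c i * X (s i) w).
  by apply: measurable_sum => i; exact: measurable_funM.
have := expectation_lin_sq n (fun i => D i * a (s i)) s.
have := expectation_lin_sq n (fun i => - (D i * b (s i))) s.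
rewrite expectation.unlock => E2 E1.
rewrite sqnorm2E.
under eq_integral do rewrite Re_Rsum Im_Rsum EFinD.
rewrite ge0_integralD//; last 4 first.
- by move=> w _; rewrite lee_fin sqr_ge0.
- by apply/measurable_EFinP; apply: measurable_funX; exact: (mS (fun i => D i * a (s i))).
- by move=> w _; rewrite lee_fin sqr_ge0.
- by apply/measurable_EFinP; apply: measurable_funX; exact: (mS (fun i => - (D i * b (s i)))).
rewrite E1 E2 -EFinD -big_split/=; congr EFin; apply: eq_bigr => i _.
by rewrite -big_split/=; apply: eq_bigr => j _; rewrite /kernel_product/=; ring.
Qed.

Local Notation mu := (@lebesgue_measure R).

(* [E|Y|^2 <= 2 E|Y - Z|^2 + 2 E|Z|^2] is applied twice: to the truncation to
   [[-n, n]] and to a Riemann sum; hence the factor 4. *)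
Lemma ms_integral_bound (Y : Omega -> R[i]) (M : R) :
  continuous kernel_product ->
  (mu \x mu)%E.-integrable setT (EFin \o kernel_product) ->
  \int[(mu \x mu)%E]_uv kernel_product uv <= M ->
  is_ms_integral P (fun t w => (X t w)%:C * conjc (g t)) Y ->
  (sqnorm2 P Y <= (4 * M)%:E)%E.
Proof.
move=> ck ik kM [mY [I Ion Ilim]].
apply/lee_addgt0Pr => e e0.
(* The chain of estimates ends in 4 M + 14 eta. *)
pose eta := e / 14.
have eta0 : 0 < eta by rewrite divr_gt0.
have [B B0 IB] := Ilim _ eta0.
have /cvgrPdist_lt/(_ _ eta0) cn := cvg_square_integral ik.
near \oo => n.
have Bn : B < n%:R by near: n; exact: nbhs_infty_gtr.
have n0 : (0 : R) < n%:R by exact: lt_trans Bn.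
have nn : - n%:R < n%:R :> R by rewrite gtrN.
have [mI Isum] := Ion _ _ nn.
have [delta delta0 Idelta] := Isum _ eta0.
have [N /= [/andP[D0 Ddelta] gE dR]] := double_riemann_sum ck ik nn delta0 eta0.
set D := (_ / _) in D0 Ddelta gE dR.
have leD2 (x y : \bar R) (r1 r2 : R) : (x <= r1%:E)%E -> (y <= r2%:E)%E ->
    (2%:E * x + 2%:E * y <= (2 * r1 + 2 * r2)%:E)%E.
  move=> xr yr; have -> : (2 * r1 + 2 * r2)%:E = (2%:E * r1%:E + 2%:E * r2%:E)%E.
    by rewrite -!EFinM -EFinD.
  by rewrite leeD// lee_wpmul2l.
pose t := grid (- n%:R) D.
have tD i : t i.+1 - t i = D by rewrite /t gridS addrC addKr.
pose Z := Rsum N.+1 (fun i => t i.+1 - t i) t.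
have sqZ : (sqnorm2 P Z <= (M + 2 * eta)%:E)%E.
  rewrite sqnorm2_Rsum lee_fin.
  under eq_bigr do under eq_bigr do rewrite !tD.
  move: dR; rewrite ler_norml => /andP[_]; rewrite lerBlDr => /le_trans; apply.
  have : `|\int[(mu \x mu)%E]_uv kernel_product uv -
     \int[(mu \x mu)%E]_uv (square_indic `[- n%:R, n%:R] uv * kernel_product uv)| < eta.
    by near: n.
  by rewrite ltr_norml => /andP[+ _]; lra.
have sqIZ : (sqnorm2 P (fun w => (I (- n%:R) n%:R w - Z w)%R) <= eta%:E)%E.
  apply/ltW; apply: Idelta => [|i iN]; last by rewrite tD.
  split; [by rewrite /t /grid mul0r addr0|exact: gE|].
  by move=> i iN; rewrite lexx grid_le// ltW.
have sqI : (sqnorm2 P (I (- n%:R)%R n%:R%R) <= (2 * eta + 2 * (M + 2 * eta))%:E)%E.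
  apply: (le_trans (sqnorm2_le mI (cmeasurable_Rsum N.+1 (fun i => t i.+1 - t i) t))).
  exact: leD2.
have YI : (sqnorm2 P (fun w => (Y w - I (- n%:R) n%:R w)%R) <= eta%:E)%E.
  by apply/ltW/IB => //; rewrite ltrN2.
apply: (le_trans (sqnorm2_le mY mI)).
have -> : (4 * M)%:E + e%:E = (2 * eta + 2 * (2 * eta + 2 * (M + 2 * eta)))%:E.
  by rewrite -EFinD; congr EFin; rewrite /eta; field.
exact: leD2.
Unshelve. all: by end_near. Qed.
End second_order_process.

(** * The Fourier transform of the m-wavelet vanishes at 0 *)

Section wavelet_at_zero.
Context {R : realType}.
Local Notation mu := (@lebesgue_measure R).

(** A constant passes through finite sums; dividing by [r] carries this to the supremum, hence the
    separate case [r = 0]. *)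
Lemma mule_esum_le (T : choiceType) (D : set T) (F : T -> \bar R) (r : R) : 0 <= r ->
  (forall i, 0 <= F i)%E -> (r%:E * (\esum_(i in D) F i) <= \esum_(i in D) (r%:E * F i))%E.
Proof.
move=> r0 F0; have [->|r1] := eqVneq r 0.
  by rewrite mul0e esum_ge0// => i _; rewrite mul0e.
have {r1}r0 : 0 < r by rewrite lt_def r1.
rewrite -lee_pdivlMl//; apply: ub_ereal_sup => _ [X DX <-].
rewrite lee_pdivlMl// ge0_mule_fsumr//.
by apply: ereal_sup_ubound; exists X.
Qed.

(** A null set cannot contain an interval of length 2e. *)
Lemma ae_near0 (Q : R -> Prop) (e : R) : {ae mu, forall y, Q y} -> 0 < e ->
  exists2 y, `|y| < e & Q y.
Proof.
move=> aeQ e0; apply: contrapT => nQ.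
have [A [mA A0 QA]] := aeQ.
have : (mu `](- e)%R, e[%classic <= mu A)%E.
  apply: le_measure; rewrite ?inE//.
  move=> y /=; rewrite in_itv/= -ltr_norml => ye; apply: QA => /= Qy.
  by apply: nQ; exists y.
rewrite A0 lebesgue_measure_itv/= lte_fin gtrN// -EFinB lee_fin opprK.
by rewrite leNgt addr_gt0.
Qed.

Lemma ae_forall_int (Q : int -> R -> Prop) : (forall k, {ae mu, forall y, Q k y}) ->
  {ae mu, forall y, forall k, Q k y}.
Proof.
move=> aeQ; have : {ae mu, forall y, forall n : nat, Q n%:Z y /\ Q (- n%:Z) y}.
  by apply: ae_foralln => n; apply: filterI; exact: aeQ.
apply: (@filterS _ _ (ae_filter_ringOfSetsType mu)) => y Qy [] n; first by have [q _] := Qy n.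
by rewrite NegzE; have [_ q] := Qy n.+1.
Qed.

Lemma esum_int_even_odd (F : int -> \bar R) : (forall k, 0 <= F k)%E ->
  \esum_(k in [set: int]) F k =
  ((\esum_(k in [set: int]) F (2 * k)%R) + (\esum_(k in [set: int]) F (2 * k + 1)%R))%E.
Proof.
move=> F0; rewrite (esumID (range (fun k : int => 2 * k)))// !setTI; congr (_ + _)%E.
  by rewrite esum_image// => i j _ _; lia.
rewrite (_ : ~` _ = range (fun k : int => 2 * k + 1)).
  by rewrite esum_image// => i j _ _; lia.
apply/seteqP; split => [k /= nk|k /= [l _ <-] [m _]]; last by lia.
have [l [kl|kl]] : exists l : int, k = 2 * l \/ k = 2 * l + 1.
  exists (k %/ 2)%Z; have := divz_eq k 2.
  have := modz_ge0 k (isT : (2 : int) != 0); have := ltz_pmod k (isT : (0 : int) < 2).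
  by move: (k %% 2)%Z (k %/ 2)%Z => r q; lia.
  by exfalso; apply: nk; exists l.
by exists l.
Qed.

Lemma normc_expi (x : R) : cabs (expi x) = 1.
Proof. by rewrite /expi/= cos2Dsin2 sqrtr1. Qed.

Lemma normc_conj (z : R[i]) : cabs (conjc z) = cabs z.
Proof. by case: z => x y /=; rewrite sqrrN. Qed.

Lemma periodic_int (m0 : R -> R[i]) (l : int) y :
  (forall y, m0 (y + 2 * pi) = m0 y) -> m0 (y + 2 * pi * l%:~R) = m0 y.
Proof.
move=> per; have pern (n : nat) x : m0 (x + 2 * pi * n%:R) = m0 x.
  elim: n x => [|n IH] x; first by rewrite mulr0 addr0.
  rewrite (_ : _ + _ = (x + 2 * pi * n%:R) + 2 * pi); last by rewrite -natr1; ring.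
  by rewrite per IH.
case: l => n; first exact: pern.
rewrite NegzE mulrNz mulrN; have := pern n.+1 (y - 2 * pi * n.+1%:R).
by rewrite subrK => <-.
Qed.

(* Splitting [sum_k |phi^(2y + 2 pi k)|^2 = 1] into even and odd [k] bounds
   [|m0(y)|^2 + |m0(y + pi)|^2] by 1. *)
Lemma low_high_pass_le (phi psi : R -> R[i]) : f_wavelet phi -> m_wavelet phi psi ->
  {ae mu, forall y, cabs (fourier psi (2 * y)) ^+ 2 + cabs (fourier phi (2 * y)) ^+ 2 <=
     cabs (fourier phi y) ^+ 2}.
Proof.
move=> [_ _ _ sum1 _] [_ [m0 [per _ ref] psiE]].
set h := fourier phi in sum1 ref psiE *.
have n2 : (2 : R) != 0 by [].
have n1 : (1 : R) != 0 by [].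
(* The normalisation is used at y, y + pi and 2y, the formula for psi^ at 2y, and the refinement
   equation at all 2y + 2 pi k; countably many null sets are discarded. *)
have a1 := ae_affine pi n1 sum1.
have a2 := ae_affine 0 n2 sum1.
have a3 := ae_affine 0 n2 psiE.
have a4 : {ae mu, forall y, forall k : int,
    h (2 * y + 2 * pi * k%:~R) =
    m0 ((2 * y + 2 * pi * k%:~R) / 2) * h ((2 * y + 2 * pi * k%:~R) / 2)}.
  by apply: ae_forall_int => k; exact: (ae_affine _ n2 ref).
have aeF := ae_filter_ringOfSetsType mu.
have := @filterI _ _ aeF _ _ (@filterI _ _ aeF _ _ sum1 a1)
  (@filterI _ _ aeF _ _ a2 (@filterI _ _ aeF _ _ a3 a4)).
apply: (@filterS _ _ aeF) => y [[E1 Epi] [E2 [Epsi Eref]]].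
move: (y : R) E1 Epi E2 Epsi Eref => {}y E1 Epi E2 Epsi Eref.
pose N u := (cabs (h u) ^+ 2)%:E.
have N0 u : (0 <= N u)%E by rewrite lee_fin sqr_ge0.
pose A := cabs (m0 y) ^+ 2; pose B := cabs (m0 (y + pi)) ^+ 2.
have A0 : 0 <= A by rewrite sqr_ge0.
have B0 : 0 <= B by rewrite sqr_ge0.
rewrite addr0 in E2; rewrite addr0 in Epsi; rewrite mul1r in Epi.
have E2k k : N (2 * y + 2 * pi * k%:~R) =
    ((cabs (m0 (y + pi * k%:~R)%R) ^+ 2)%:E * N (y + pi * k%:~R)%R)%E.
  rewrite /N Eref ComplexField.Normc.normcM exprMn EFinM.
  by rewrite (_ : (_ + _) / 2 = y + pi * k%:~R); last by field.
have AB1 : A + B <= 1.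
  have key : ((A + B)%:E <= \esum_(k in [set: int]) N (2 * y + 2 * pi * k%:~R)%R)%E.
    (* By periodicity even k evaluate [m0] at y and odd k at y + pi; the remaining sums are the
       normalisation at y and at y + pi. *)
    rewrite esum_int_even_odd// EFinD; apply: leeD.
      have := @mule_esum_le _ [set: int] (fun k => N (y + 2 * pi * k%:~R)) A A0 (fun=> N0 _).
      have -> : \esum_(k in [set: int]) N (y + 2 * pi * k%:~R) = 1%E by exact: E1.
      rewrite mule1 => /le_trans; apply; apply: le_esum => k _.
      rewrite E2k (_ : y + pi * (2 * k)%:~R = y + 2 * pi * k%:~R).
        by rewrite periodic_int.
      by rewrite intrM; ring.
    have := @mule_esum_le _ [set: int] (fun k => N (y + pi + 2 * pi * k%:~R)) B B0 (fun=> N0 _).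
    have -> : \esum_(k in [set: int]) N (y + pi + 2 * pi * k%:~R) = 1%E by exact: Epi.
    rewrite mule1 => /le_trans; apply; apply: le_esum => k _.
    rewrite E2k (_ : y + pi * (2 * k + 1)%:~R = y + pi + 2 * pi * k%:~R).
      by rewrite periodic_int.
    by rewrite intrD intrM; ring.
  have E2' : \esum_(k in [set: int]) N (2 * y + 2 * pi * k%:~R) = 1%E by exact: E2.
  by rewrite E2' lee_fin in key.
have hy2 : h (2 * y) = m0 y * h y.
  by have := Eref 0; rewrite mulr0 addr0 => ->; rewrite (mulrC 2 y) mulfK.
have py2 : cabs (fourier psi (2 * y)) ^+ 2 = B * cabs (h y) ^+ 2.
  rewrite Epsi !ComplexField.Normc.normcM normc_conj normc_expi mulr1 exprMn /B.
  by rewrite (mulrC 2 y) mulfK.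
(* The two terms on the left are B |phi^(y)|^2 and A |phi^(y)|^2, so A + B <= 1 concludes. *)
rewrite py2 hy2 ComplexField.Normc.normcM exprMn -/A -mulrDl addrC ler_piMl ?sqr_ge0//.
Qed.

(** Stated with real moduli, because the norm behind the topology of [R[i]^o] takes its values in
    [R[i]]. *)
Definition ccontinuous_at (f : R -> R[i]) (x : R) : Prop :=
  forall e, 0 < e -> exists2 delta, 0 < delta & forall y, `|y - x| < delta ->
    cabs (f y - f x) < e.

Lemma ccontinuous_atP (f : R -> R[i]) x : {for x, continuous (f : R -> R[i]^o)} ->
  ccontinuous_at f x.
Proof.
move=> /cvgrPdist_lt cf e e0.
have e0' : 0 < e%:C by rewrite ltcR.
have [dl /= dl0 Hd] := cf _ e0'; exists dl => // y yx.
have := Hd y; rewrite /= distrC => /(_ yx); rewrite distrC.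
by rewrite -ltcR.
Qed.

Lemma normc_dist (a b : R[i]) : `|cabs a - cabs b| <= cabs (a - b).
Proof.
have tri (x y : R[i]) : cabs x <= cabs (x - y) + cabs y.
  by rewrite -lecR rmorphD /= -{1}(subrK y x); exact: (@ler_normD _ R[i]).
have sym : cabs (a - b) = cabs (b - a).
  by apply: complexI; exact: (@distrC R[i] R[i]).
have := tri a b; have := tri b a; rewrite -sym ler_norml; lra.
Qed.

Lemma ccontinuous_at_sqr (f : R -> R[i]) x : ccontinuous_at f x ->
  {for x, continuous (fun y => cabs (f y) ^+ 2 : R)}.
Proof.
move=> cf; apply: (cvg_comp (fun y => cabs (f y)) (fun y => y ^+ 2));
  last exact: exprn_continuous.
apply/cvgrPdist_lt => e e0; have [dl dl0 Hd] := cf e e0.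
exists dl => //= y xy; rewrite distrC; apply: le_lt_trans (normc_dist _ _) _; apply: Hd.
by rewrite distrC.
Qed.

Lemma fourier_m_wavelet_0 (phi psi : R -> R[i]) : f_wavelet phi -> m_wavelet phi psi ->
  ccontinuous_at (fourier psi) 0 -> fourier psi 0 = 0.
Proof.
move=> fw mw cpsi; have ae_le := low_high_pass_le fw mw.
have cphi : ccontinuous_at (fourier phi) 0 by apply: ccontinuous_atP; case: fw.
move: (fourier psi) (fourier phi) cpsi cphi ae_le => psih phih cpsi cphi ae_le.
pose p y : R := cabs (psih y) ^+ 2; pose h y : R := cabs (phih y) ^+ 2.
have /cvgrPdist_lt P : {for 0, continuous p} := ccontinuous_at_sqr cpsi.
have /cvgrPdist_lt H : {for 0, continuous h} := ccontinuous_at_sqr cphi.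
suff : p 0 == 0.
  by rewrite expf_eq0 => /eqP/ComplexField.Normc.eq0_normc.
rewrite eq_le {2}/p sqr_ge0 andbT; apply/ler_addgt0Pl => e e0; rewrite addr0.
have e3 : 0 < e / 3 by rewrite divr_gt0.
have [d1 /= d10 Hd1] := P _ e3; have [d2 /= d20 Hd2] := H _ e3.
(* The inequality holds only a.e., so a good y is picked near 0, within half the radius so that 2y
   is close to 0 as well. Three comparisons then cost e / 3 each. *)
have [|y yd Hy] := ae_near0 (e := Num.min d1 d2 / 2) ae_le.
  by rewrite divr_gt0// lt_min d10.
have y2 : `|2 * y| < Num.min d1 d2 by rewrite normrM ger0_norm// mulrC -ltr_pdivlMr.
have y1 : `|y| < Num.min d1 d2.
  by apply: lt_trans yd _; rewrite ltr_pdivrMr// ltr_pMr ?lt_min ?d10// ltr1n.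
move: y2 y1; rewrite !lt_min => /andP[y21 y22] /andP[y11 y12].
have := Hd1 (2 * y); rewrite /= sub0r normrN => /(_ y21).
have := Hd2 (2 * y); rewrite /= sub0r normrN => /(_ y22).
have := Hd2 y; rewrite /= sub0r normrN => /(_ y12).
have {Hy} : p (2 * y) + h (2 * y) <= h y := Hy.
rewrite !ltr_norml => Hy /andP[h1 h2] /andP[h3 h4] /andP[h5 h6].
by move: (p 0) (p (2 * y)) (h 0) (h y) (h (2 * y)) Hy h1 h2 h3 h4 h5 h6 => *; lra.
Qed.

End wavelet_at_zero.

(** * Fourier transforms of dyadic wavelets *)

Section wavelet_transform.
Context {R : realType}.
Local Notation mu := (@lebesgue_measure R).
Implicit Types (g : R -> R[i]).

Lemma normr_Re_le (z : R[i]) : `|complex.Re z| <= cabs z.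
Proof. by case: z => x y /=; rewrite -sqrtr_sqr ler_wsqrtr// lerDl sqr_ge0. Qed.

Lemma normr_Im_le (z : R[i]) : `|complex.Im z| <= cabs z.
Proof. by case: z => x y /=; rewrite -sqrtr_sqr ler_wsqrtr// lerDr sqr_ge0. Qed.

Lemma continuous_Re g : continuous (g : R -> R[i]^o) -> continuous (fun x => complex.Re (g x)).
Proof.
move=> cg x; have /ccontinuous_atP cgx := cg x.
apply/cvgrPdist_lt => e e0; have [dl dl0 Hd] := cgx e e0.
exists dl => //= y xy; rewrite -raddfB; apply: le_lt_trans (normr_Re_le _) _.
have -> : cabs (g x - g y) = cabs (g y - g x) by apply: complexI; exact: (@distrC R[i] R[i]).
by apply: Hd; rewrite distrC.
Qed.

Lemma continuous_Im g : continuous (g : R -> R[i]^o) -> continuous (fun x => complex.Im (g x)).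
Proof.
move=> cg x; have /ccontinuous_atP cgx := cg x.
apply/cvgrPdist_lt => e e0; have [dl dl0 Hd] := cgx e e0.
exists dl => //= y xy; rewrite -raddfB; apply: le_lt_trans (normr_Im_le _) _.
have -> : cabs (g x - g y) = cabs (g y - g x) by apply: complexI; exact: (@distrC R[i] R[i]).
by apply: Hd; rewrite distrC.
Qed.

(** A violation at one point would persist on a neighbourhood, which is not null. This turns the
    a.e. bound of Assumption S into one valid everywhere. *)
Lemma ae_le_bounded g (B : R) : continuous (g : R -> R[i]^o) ->
  {ae mu, forall x, cabs (g x) <= B} -> forall x, cabs (g x) <= B.
Proof.
move=> cg aeB x; rewrite leNgt; apply/negP => Bx.
have /ccontinuous_atP cgx := cg x.
have e0 : 0 < cabs (g x) - B by rewrite subr_gt0.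
have [dl dl0 Hd] := cgx _ e0.
have [y yd By] := ae_near0 (ae_affine x (oner_neq0 R) aeB) dl0.
have := Hd (1 * y + x); rewrite mul1r addrK => /(_ yd).
have := normc_dist (g (y + x)) (g x); rewrite mul1r in By; rewrite ler_norml => /andP[h1 _] h2.
by move: By h1 h2 => ? ? ?; lra.
Qed.

Section decay.
Variables (Phi : R -> R) (g : R -> R[i]).
Hypotheses (gS : assumption_S Phi g) (cg : continuous (g : R -> R[i]^o)).

Lemma assumption_S_bounded x : cabs (g x) <= Phi 0.
Proof.
case: gS => [Phi0 PhiM gPhi _]; apply: ae_le_bounded => //.
have aeF := ae_filter_ringOfSetsType mu.
apply: (@filterS _ _ aeF _ _ _ gPhi) => y /le_trans; apply.
exact: PhiM.
Qed.

Lemma measurable_Phi_norm : measurable_fun setT (fun x : R => Phi `|x|).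
Proof.
case: gS => [Phi0 PhiM _ _].
(* [Phi] is known to be monotone only on [0, +oo[; clipping at 0 makes it monotone on the line
   without changing its value at |x|. *)
have mPhi : measurable_fun setT (fun x : R => Phi (Num.max 0 x)).
  apply: nonincreasing_measurable => // x y xy; apply: PhiM.
    by rewrite le_max lexx.
  by rewrite ge_max le_max lexx/= le_max xy orbT.
have := measurableT_comp mPhi (@normr_measurable R setT).
by congr measurable_fun; apply/funext => x /=; rewrite max_r.
Qed.

Lemma assumption_S_integrable (f : R -> R) : measurable_fun setT f ->
  (forall x, `|f x| <= cabs (g x)) -> mu.-integrable setT (EFin \o f).
Proof.
case: gS => [Phi0 PhiM gPhi iPhi] mf fg; apply/integrableP; split.
  exact/measurable_EFinP.
apply: le_lt_trans iPhi; apply: ae_ge0_le_integral => //.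
- by apply/measurable_EFinP; exact: measurableT_comp.
- by move=> x _; rewrite lee_fin Phi0.
- by apply/measurable_EFinP; exact: measurable_Phi_norm.
- have aeF := ae_filter_ringOfSetsType mu.
  by apply: (@filterS _ _ aeF _ _ _ gPhi) => y gy _; rewrite /= lee_fin (le_trans (fg y)).
Qed.

Lemma assumption_S_integrable_Re : mu.-integrable setT (fun x => (complex.Re (g x))%:E).
Proof.
apply: assumption_S_integrable; last by move=> x; exact: normr_Re_le.
by apply: continuous_measurable_fun; exact: continuous_Re.
Qed.

Lemma assumption_S_integrable_Im : mu.-integrable setT (fun x => (complex.Im (g x))%:E).
Proof.
apply: assumption_S_integrable; last by move=> x; exact: normr_Im_le.
by apply: continuous_measurable_fun; exact: continuous_Im.
Qed.

End decay.

Section real_parts.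
Variable g : R -> R[i].
Local Notation a := (fun x => complex.Re (g x)).
Local Notation b := (fun x => complex.Im (g x)).
Hypotheses (ia : mu.-integrable setT (EFin \o a)) (ib : mu.-integrable setT (EFin \o b)).

Lemma Re_fourier z : complex.Re (fourier g z) = cos_transform a z + sin_transform b z.
Proof.
rewrite /cos_transform /sin_transform -RintegralD//;
  [|exact: integrable_mul_cos|exact: integrable_mul_sin].
by apply: eq_Rintegral => x _; case: (g x) => u v /=; rewrite cosN sinN; ring.
Qed.

Lemma Im_fourier z : complex.Im (fourier g z) = cos_transform b z - sin_transform a z.
Proof.
rewrite /cos_transform /sin_transform -RintegralB//;
  [|exact: integrable_mul_cos|exact: integrable_mul_sin].
by apply: eq_Rintegral => x _; case: (g x) => u v /=; rewrite cosN sinN; ring.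
Qed.

Variable W : R -> R.
Hypotheses (gW : forall z, cabs (fourier g z) <= W z) (WN : forall z, W (- z) = W z).

Let sq_le z : (cos_transform a z + sin_transform b z) ^+ 2 +
  (cos_transform b z - sin_transform a z) ^+ 2 <= W z ^+ 2.
Proof.
have W0 : 0 <= W z by apply: le_trans (gW z); rewrite normc_ReIm sqrtr_ge0.
have := gW z; rewrite normc_ReIm Re_fourier Im_fourier -ler_sqr ?nnegrE ?sqrtr_ge0//.
by rewrite sqr_sqrtr// addr_ge0 ?sqr_ge0.
Qed.

(* Average of [sq_le] at [z] and [- z]: the transforms of the real and imaginary
   parts are [(g^(z) + conj g^(-z))/2] and [(g^(z) - conj g^(-z))/(2i)]. *)
Let sum_sq_le z : cos_transform a z ^+ 2 + sin_transform a z ^+ 2 +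
  (cos_transform b z ^+ 2 + sin_transform b z ^+ 2) <= W z ^+ 2.
Proof.
have := sq_le z; have := sq_le (- z).
rewrite WN !cos_transformN (sin_transformN ia) (sin_transformN ib).
move: (cos_transform a z) (sin_transform a z) (cos_transform b z) (sin_transform b z) (W z ^+ 2).
by move=> x y u v w; rewrite !expr2 => *; lra.
Qed.

Let W_ge0 z : 0 <= W z.
Proof. by apply: le_trans (gW z); rewrite normc_ReIm sqrtr_ge0. Qed.

(** The Parseval inequality concerns real functions, so the two parts of a wavelet are treated
    separately, with one common even majorant [W]. *)
Lemma transform_Re_le z : Num.sqrt (cos_transform a z ^+ 2 + sin_transform a z ^+ 2) <= W z.
Proof.
rewrite -[leRHS]ger0_norm// -sqrtr_sqr ler_wsqrtr// (le_trans _ (sum_sq_le z))//.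
by rewrite lerDl addr_ge0 ?sqr_ge0.
Qed.

Lemma transform_Im_le z : Num.sqrt (cos_transform b z ^+ 2 + sin_transform b z ^+ 2) <= W z.
Proof.
rewrite -[leRHS]ger0_norm// -sqrtr_sqr ler_wsqrtr// (le_trans _ (sum_sq_le z))//.
by rewrite lerDr addr_ge0 ?sqr_ge0.
Qed.

End real_parts.

Section dyadic.
Variable psi : R -> R[i].
Hypotheses (ia : mu.-integrable setT (fun x => (complex.Re (psi x))%:E))
  (ib : mu.-integrable setT (fun x => (complex.Im (psi x))%:E)).
Variables (j : nat) (k : int).

Let c : R := 2 `^ (j%:R / 2).
Let l : R := 2 ^+ j.

Let l0 : l != 0. Proof. by rewrite expf_neq0. Qed.

Lemma dyadic_Re x : complex.Re (dyadic psi j k x) = c * complex.Re (psi (l * x - k%:~R)).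
Proof. by rewrite /dyadic -/c -/l; case: (psi _) => u v /=; ring. Qed.

Lemma dyadic_Im x : complex.Im (dyadic psi j k x) = c * complex.Im (psi (l * x - k%:~R)).
Proof. by rewrite /dyadic -/c -/l; case: (psi _) => u v /=; ring. Qed.

Lemma normc_dyadic x : cabs (dyadic psi j k x) = c * cabs (psi (l * x - k%:~R)).
Proof.
rewrite /dyadic ComplexField.Normc.normcM /= expr0n/= addr0 sqrtr_sqr ger0_norm// powR_ge0.
Qed.

Lemma integrable_dyadic_Re : mu.-integrable setT (fun x => (complex.Re (dyadic psi j k x))%:E).
Proof.
have := integrableZl measurableT c (integrable_affine (- k%:~R) l0 ia).
by apply: eq_integrable => // x _; rewrite dyadic_Re EFinM.
Qed.

Lemma integrable_dyadic_Im : mu.-integrable setT (fun x => (complex.Im (dyadic psi j k x))%:E).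
Proof.
have := integrableZl measurableT c (integrable_affine (- k%:~R) l0 ib).
by apply: eq_integrable => // x _; rewrite dyadic_Im EFinM.
Qed.

Lemma continuous_dyadic_Re : continuous (psi : R -> R[i]^o) ->
  continuous (fun x => complex.Re (dyadic psi j k x)).
Proof.
move=> /continuous_Re cpsi x; rewrite /continuous_at; under eq_fun do rewrite dyadic_Re.
rewrite dyadic_Re; apply: cvgMr.
apply: (cvg_comp (fun y => l * y - k%:~R) (fun y => complex.Re (psi y))); last exact: cpsi.
by apply: cvgB; [apply: cvgMr; exact: cvg_id|exact: cvg_cst].
Qed.

Lemma continuous_dyadic_Im : continuous (psi : R -> R[i]^o) ->
  continuous (fun x => complex.Im (dyadic psi j k x)).
Proof.
move=> /continuous_Im cpsi x; rewrite /continuous_at; under eq_fun do rewrite dyadic_Im.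
rewrite dyadic_Im; apply: cvgMr.
apply: (cvg_comp (fun y => l * y - k%:~R) (fun y => complex.Im (psi y))); last exact: cpsi.
by apply: cvgB; [apply: cvgMr; exact: cvg_id|exact: cvg_cst].
Qed.

Lemma fourier_dyadic z : fourier (dyadic psi j k) z =
  (c / l)%:C * expi (- (z * k%:~R / l)) * fourier psi (z / l).
Proof.
pose u := z / l.
pose p (y : R) := complex.Re (expi (- (u * y)) * psi y).
pose q (y : R) := complex.Im (expi (- (u * y)) * psi y).
have mc : measurable_fun setT (fun y => cos (- (u * y))).
  by under eq_fun do rewrite cosN; exact: measurable_cosM.
have ms : measurable_fun setT (fun y => sin (- (u * y))).
  by under eq_fun do rewrite -mulNr; exact: measurable_sinM.
have ip : mu.-integrable setT (EFin \o p).
  have h1 := integrable_bounded_mulR mc (fun y => normr_cos _) ia.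
  have h2 := integrable_bounded_mulR ms (fun y => normr_sin _) ib.
  have := integrableB measurableT h1 h2.
  by apply: eq_integrable => // y _; rewrite /= /p; case: (psi y).
have iq : mu.-integrable setT (EFin \o q).
  have h1 := integrable_bounded_mulR mc (fun y => normr_cos _) ib.
  have h2 := integrable_bounded_mulR ms (fun y => normr_sin _) ia.
  have := integrableD measurableT h1 h2.
  by apply: eq_integrable => // y _; rewrite /= /q; case: (psi y).
pose e1 := cos (- (z * k%:~R / l)); pose e2 := sin (- (z * k%:~R / l)).
(* The first summand does not depend on x and becomes the unimodular factor; the second is the phase
   of psi^(u) after the substitution y = 2^j x - k. *)
have phase x : - (z * x) = - (z * k%:~R / l) + - (u * (l * x - k%:~R)).
  by rewrite /u; field.
have ipa := integrable_affine (- k%:~R) l0 ip.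
have iqa := integrable_affine (- k%:~R) l0 iq.
have normp : \int[mu]_x p (l * x - k%:~R) = l^-1 * complex.Re (fourier psi u).
  by rewrite Rintegral_affine// ger0_norm// exprn_ge0.
have normq : \int[mu]_x q (l * x - k%:~R) = l^-1 * complex.Im (fourier psi u).
  by rewrite Rintegral_affine// ger0_norm// exprn_ge0.
have iZ (r : R) (f : R -> R) : mu.-integrable setT (EFin \o f) ->
    mu.-integrable setT (fun x => (r * f x)%:E).
  by move=> fi; have := integrableZl measurableT r fi; apply: eq_integrable => // x _;
    rewrite EFinM.
have E : fourier (dyadic psi j k) z =
    (\int[mu]_x (c * e1 * p (l * x - k%:~R) - c * e2 * q (l * x - k%:~R))) +i*
    (\int[mu]_x (c * e2 * p (l * x - k%:~R) + c * e1 * q (l * x - k%:~R))).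
  rewrite /fourier /cintegral; congr (_ +i* _); apply: eq_Rintegral => x _.
    rewrite /p /q /dyadic -/c -/l /expi (phase x) cosD sinD -/e1 -/e2.
    by case: (psi _) => v w /=; ring.
  rewrite /p /q /dyadic -/c -/l /expi (phase x) cosD sinD -/e1 -/e2.
  by case: (psi _) => v w /=; ring.
rewrite E RintegralB ?RintegralD ?RintegralZl//; try exact: iZ.
rewrite normp normq /expi -/e1 -/e2 -/u; case: (fourier psi u) => v w /=.
by apply/eqP; rewrite eq_complex /=; apply/andP; split; apply/eqP; ring.
Qed.

(** The translation k survives only in a unimodular factor, which makes the coefficient bounds
    uniform in k. Here c / l = 2^{-j/2}. *)
Lemma normc_fourier_dyadic z :
  cabs (fourier (dyadic psi j k) z) = c / l * cabs (fourier psi (z / l)).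
Proof.
rewrite fourier_dyadic !ComplexField.Normc.normcM normc_expi mulr1.
congr (_ * _); rewrite /= expr0n/= addr0 sqrtr_sqr ger0_norm//.
by rewrite divr_ge0 ?powR_ge0 ?exprn_ge0.
Qed.

End dyadic.
End wavelet_transform.

(** * Bounds on the wavelet coefficients *)

Section coefficient_bounds.
Context d (Omega : measurableType d) (R : realType) (P : probability Omega R).
Variable X : R -> {RV P >-> R}.
Hypothesis Xsq : forall t, ('E_P[fun w => (X t w ^+ 2)%R] < +oo)%E.
Hypothesis Rcont : continuous (fun ts : R * R => covfun X ts.1 ts.2).
Local Notation mu := (@lebesgue_measure R).
Local Notation mu2 := (mu \x mu)%E.
Hypothesis Rint : mu2.-integrable setT (fun uv => (covfun X uv.1 uv.2)%:E).

Variables (g : R -> R[i]) (B : R).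
Hypothesis cRe : continuous (fun x => complex.Re (g x)).
Hypothesis cIm : continuous (fun x => complex.Im (g x)).
Hypothesis gB : forall x, cabs (g x) <= B.
Variable Y : Omega -> R[i].
Hypothesis msY : is_ms_integral P (fun t w => (X t w)%:C * conjc (g t)) Y.

Let ReB x : `|complex.Re (g x)| <= B.
Proof. exact: le_trans (normr_Re_le _) (gB x). Qed.

Let ImB x : `|complex.Im (g x)| <= B.
Proof. exact: le_trans (normr_Im_le _) (gB x). Qed.

Let ckernel : continuous (kernel_product X g).
Proof.
move=> uv; apply: cvgM; first exact: Rcont.
have c1 (f : R -> R) : continuous f -> f uv'.1 @[uv' --> uv] --> f uv.1.
  by move=> cf; apply: (cvg_comp fst f); [exact: cvg_fst|exact: cf].
have c2 (f : R -> R) : continuous f -> f uv'.2 @[uv' --> uv] --> f uv.2.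
  by move=> cf; apply: (cvg_comp snd f); [exact: cvg_snd|exact: cf].
by apply: cvgD; apply: cvgM; [exact: (c1 _ cRe)|exact: (c2 _ cRe)|exact: (c1 _ cIm)|exact: (c2 _
  cIm)].
Qed.

Let iRe := integrable_kernel_mul cRe ReB Rint.
Let iIm := integrable_kernel_mul cIm ImB Rint.

Let kernelE uv : kernel_product X g uv =
  covfun X uv.1 uv.2 * (complex.Re (g uv.1) * complex.Re (g uv.2)) +
  covfun X uv.1 uv.2 * (complex.Im (g uv.1) * complex.Im (g uv.2)).
Proof. by rewrite /kernel_product mulrDr. Qed.

Let ikernel : mu2.-integrable setT (EFin \o kernel_product X g).
Proof.
have := integrableD measurableT iRe iIm.
by apply: eq_integrable => // uv _; rewrite /= kernelE EFinD.
Qed.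

(** The real and the imaginary products are each at most B^2 in modulus; the 4 is the loss in
    [ms_integral_bound]. *)
Lemma sqnorm2_le_L1 :
  (sqnorm2 P Y <= (4 * (2 * B ^+ 2 * \int[mu2]_uv `|covfun X uv.1 uv.2|))%:E)%E.
Proof.
apply: (ms_integral_bound Xsq ckernel ikernel _ msY).
rewrite -RintegralZl//; last exact: integrable_norm.
apply: le_Rintegral => //.
  have := integrableZl measurableT (2 * B ^+ 2) (integrable_norm Rint).
  by apply: eq_integrable => // uv _; rewrite /= EFinM.
move=> uv _; apply: le_trans (ler_norm _) _.
rewrite /kernel_product normrM mulrC ler_wpM2r//.
apply: le_trans (ler_normD _ _) _; rewrite !normrM mulr_natl mulr2n expr2.
by apply: lerD; exact: ler_pM.
Qed.

Variables (W : R -> R) (M : R).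
Hypothesis mW : measurable_fun setT W.
Hypothesis WN : forall z, W (- z) = W z.
Hypothesis gW : forall z, cabs (fourier g z) <= W z.
Hypothesis iReg : mu.-integrable setT (fun x => (complex.Re (g x))%:E).
Hypothesis iImg : mu.-integrable setT (fun x => (complex.Im (g x))%:E).
Hypothesis SWM : (\int[mu2]_zw
  (cabs (fourier2 (covfun X) zw.1 zw.2) * W zw.1 * W zw.2)%:E <= M%:E)%E.

(** One Parseval bound for the real part and one for the imaginary part, times the loss 4 of
    [ms_integral_bound], give the 8. *)
Lemma sqnorm2_le_fourier : (sqnorm2 P Y <= (8 * M / (2 * pi) ^+ 2)%:E)%E.
Proof.
have -> : 8 * M / (2 * pi) ^+ 2 = 4 * (M / (2 * pi) ^+ 2 + M / (2 * pi) ^+ 2) :> R.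
  by have := lt0r_neq0 (pi_gt0 R); move: (pi : R) => q q0; field.
apply: (ms_integral_bound Xsq ckernel ikernel _ msY).
have -> : \int[mu2]_uv kernel_product X g uv =
    \int[mu2]_uv (covfun X uv.1 uv.2 * (complex.Re (g uv.1) * complex.Re (g uv.2))) +
    \int[mu2]_uv (covfun X uv.1 uv.2 * (complex.Im (g uv.1) * complex.Im (g uv.2))).
  by rewrite -RintegralD//; apply: eq_Rintegral => uv _; rewrite kernelE.
apply: lerD.
  apply: le_trans (ler_norm _) _.
  apply: (parseval_le cRe ReB iReg Rint mW _ SWM) => z.
  exact: (transform_Re_le iReg iImg gW WN).
apply: le_trans (ler_norm _) _.
apply: (parseval_le cIm ImB iImg Rint mW _ SWM) => z.
exact: (transform_Im_le iReg iImg gW WN).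
Qed.

End coefficient_bounds.

(** * Elementary estimates and the summation over j *)

Lemma C_S_ge0 (R : realType) (Phi : R -> R) : (forall x, 0 <= x -> 0 <= Phi x) -> 0 <= C_S Phi.
Proof.
move=> Phi0; apply: addr_ge0; apply: mulr_ge0 => //; first exact: Phi0.
apply: Rintegral_ge0 => x /=; rewrite in_itv/= andbT => x2.
by apply: Phi0; apply: le_trans x2.
Qed.

Lemma geometric_bound_lty (R : realType) (s : nat -> \bar R) (K q : R) :
  0 <= K -> 0 < q < 1 -> (forall j, 0 <= s j)%E ->
  (forall j, s j <= (K * q ^+ j)%:E)%E -> (\sum_(0 <= j <oo) s j < +oo)%E.
Proof.
move=> K0 /andP[q0 q1] s0 sK.
apply: (@le_lt_trans _ _ (K * (1 - q)^-1)%:E); last exact: ltry.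
apply: lime_le; first exact: is_cvg_nneseries.
apply: nearW => n.
have qn : `|q| < 1 by rewrite gtr0_norm.
apply: (@le_trans _ _ (series (geometric K q) n)%:E); last by rewrite lee_fin geometric_le_lim.
by rewrite /series/= -sumEFin; apply: lee_sum => j _; exact: sK.
Qed.

Lemma lipschitz_ccontinuous_at (R : realType) (f : R -> R[i]) (L alpha x : R) : 0 < alpha ->
  0 <= L ->
  (forall y z, cabs (f y - f z) <= L * `|y - z| `^ alpha) -> ccontinuous_at f x.
Proof.
(* Dividing by L + 1 covers the case L = 0. *)
move=> alpha0 L0 lip e e0; pose r := e / (L + 1).
have L1 : 0 < L + 1 by rewrite ltr_wpDl.
have r0 : 0 < r by rewrite divr_gt0.
exists (r `^ alpha^-1); first exact: powR_gt0.
move=> y yx; apply: le_lt_trans (lip _ _) _.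
have yr : `|y - x| `^ alpha < r.
  have -> : r = (r `^ alpha^-1) `^ alpha by rewrite -powRrM mulVf ?gt_eqF// powRr1// ltW.
  by apply: gt0_ltr_powR => //; rewrite nnegrE ?powR_ge0.
have -> : e = (L + 1) * r by rewrite /r; field; rewrite gt_eqF.
apply: (@le_lt_trans _ _ (L * r)); first by rewrite ler_wpM2l// ltW.
by rewrite ltr_pM2r// ltrDl.
Qed.

Lemma dyadic_scale_sq (R : realType) (j : nat) : (2 `^ (j%:R / 2)) * (2 `^ (j%:R / 2)) =
  2 ^+ j :> R.
Proof.
rewrite -powRD; last by rewrite pnatr_eq0 implybT.
by rewrite -splitr powR_mulrn.
Qed.

Lemma powR_dyadicV (R : realType) (j : nat) (alpha : R) :
  ((2 ^+ j)^-1) `^ alpha = ((2^-1) `^ alpha) ^+ j :> R.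
Proof.
rewrite -exprVn -powR_mulrn ?invr_ge0// powRAC powR_mulrn// powR_ge0.
Qed.

Lemma sqrte_le (R : realType) (x : \bar R) (r : R) : 0 <= r ->
  (x <= (r ^+ 2)%:E)%E -> (sqrte x <= r%:E)%E.
Proof.
move=> r0 xr; apply: le_trans (_ : sqrte ((r ^+ 2)%:E) <= _)%E.
  by rewrite lee_sqrt// lee_fin sqr_ge0.
by rewrite /= sqrtr_sqr ger0_norm.
Qed.

Theorem theorem7 (R : realType) (d : measure_display)
    (Omega : measurableType d) (P : probability Omega R)
    (vphi : R -> R) (X : R -> {RV P >-> R}) (T p alpha : R)
    (phi psi : R -> R[i]) (Phi c : R -> R)
    (xi : int -> Omega -> R[i]) (eta : nat -> int -> Omega -> R[i])
    (vphiN : N_function vphi) (vphiQ : assumption_Q vphi)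
    (Xstrict : strictly_Sub vphi X)
    (Xmean : forall t, ('E_P[X t] = 0)%E)
    (Xsq : forall t, ('E_P[fun w => (X t w ^+ 2)%R] < +oo)%E)
    (Rcont : continuous (fun ts : R * R => covfun X ts.1 ts.2))
    (T0 : 0 < T) (p1 : 1 <= p)
    (Xp : (\int[lebesgue_measure]_(t in `[0%R, T])
             ('E_P[fun w => (X t w ^+ 2)%R] `^ (p / 2)) < +oo)%E)
    (Rhat_ex : fourier2_exists (covfun X))
    (alpha0 : 0 < alpha)
    (Rhat_int : (\int[@lebesgue_measure R \x @lebesgue_measure R]_zw
       (cabs (fourier2 (covfun X) zw.1 zw.2)
          * `|zw.1| `^ alpha * `|zw.2| `^ alpha)%:E < +oo)%E)
    (phi_fw : f_wavelet phi) (psi_mw : m_wavelet phi psi)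
    (phi_cont : continuous (phi : R -> R[i]^o))
    (psi_cont : continuous (psi : R -> R[i]^o))
    (phiS : assumption_S Phi phi) (psiS : assumption_S Phi psi)
    (c_even : forall x, c (- x) = c x)
    (c_ndec : forall x y, 0 <= x -> x <= y -> c x <= c y)
    (c0 : 1 < c 0)
    (c_dil : exists (A : R -> R) (x0 : R),
       (forall a, 0 < a -> 0 < A a) /\
       (forall x a, x0 <= x -> 0 < a -> c (a * x) <= c x * A a))
    (c_int : (\int[@lebesgue_measure R]_x (c x * Phi `|x|)%:E < +oo)%E)
    (R_le_c : forall t, Num.sqrt `|covfun X t t| <= c t)
    (psi_lip : exists L : R, forall x y,
       cabs (fourier psi x - fourier psi y) <= L * `|x - y| `^ alpha)
    (xi_def : forall k : int,
       is_ms_integral P (fun t w => (X t w)%:C * conjc (dyadic phi 0 k t)) (xi k))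
    (eta_def : forall (j : nat) (k : int),
       is_ms_integral P (fun t w => (X t w)%:C * conjc (dyadic psi j k t))
         (eta j k)) :
  (ereal_sup [set sqrte 'E_P[fun w => (cabs (xi k w) ^+ 2)%R] | k in [set: int]]
     * (C_S Phi)%:E
   + \sum_(0 <= j <oo)
       (ereal_sup [set sqrte 'E_P[fun w => (cabs (eta j k w) ^+ 2)%R]
                  | k in [set: int]]
        * (2 `^ (j%:R / 2))%:E * (C_S Phi)%:E)
   < +oo)%E.
Proof.
have [Phi0 PhiM _ _] := phiS.
have C0 : 0 <= C_S Phi by exact: C_S_ge0.
have Rint : (@lebesgue_measure R \x @lebesgue_measure R)%E.-integrable setT
    (fun uv => (covfun X uv.1 uv.2)%:E).
  (* At z = w = 0 both exponentials are 1, so the real part of the integrand is R itself. *)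
  have [+ _] := Rhat_ex 0 0; apply: eq_integrable => // uv _.
  by rewrite /= !mul0r oppr0 cos0 sin0; congr EFin; ring.
apply: lte_add_pinfty.
  (* [r ^+ 2] is the bound of [sqnorm2_le_L1] with [B = Phi 0], the same for every k. *)
  pose r := Num.sqrt (4 * (2 * Phi 0 ^+ 2 *
    \int[(@lebesgue_measure R \x @lebesgue_measure R)%E]_uv `|covfun X uv.1 uv.2|)).
  apply: (@le_lt_trans _ _ (r * C_S Phi)%:E); last exact: ltry.
  rewrite EFinM lee_wpmul2r ?lee_fin//; apply: ub_ereal_sup => _ [k _ <-].
  apply: sqrte_le; first exact: sqrtr_ge0.
  have I0 : 0 <= \int[(@lebesgue_measure R \x @lebesgue_measure R)%E]_uv `|covfun X uv.1 uv.2|.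
    exact: Rintegral_ge0.
  rewrite sqr_sqrtr; last by apply: mulr_ge0 => //; apply: mulr_ge0 => //;
    apply: mulr_ge0 => //; exact: sqr_ge0.
  apply: (sqnorm2_le_L1 Xsq Rcont Rint _ _ _ (xi_def k)).
  - exact: continuous_dyadic_Re.
  - exact: continuous_dyadic_Im.
  - by move=> x; rewrite normc_dyadic mul0r powRr0 mul1r (assumption_S_bounded phiS).
have [L psiL] := psi_lip.
have L0 : 0 <= L.
  have := psiL 1 0; rewrite subr0 normr1 powR1 mulr1; apply: le_trans.
  by rewrite normc_ReIm sqrtr_ge0.
have psi0 : fourier psi 0 = 0.
  by apply: (fourier_m_wavelet_0 phi_fw psi_mw); exact: lipschitz_ccontinuous_at psiL.
have psiW z : cabs (fourier psi z) <= L * `|z| `^ alpha.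
  by have := psiL z 0; rewrite psi0 !subr0.
set I := (\int[_]_zw _)%E in Rhat_int.
have I0 : (0 <= I)%E.
  apply: integral_ge0 => zw _; rewrite lee_fin !mulr_ge0 ?powR_ge0//.
  by rewrite normc_ReIm sqrtr_ge0.
have IJ : I = (fine I)%:E by rewrite fineK// ge0_fin_numE.
set J := fine I in IJ.
have J0 : 0 <= J by rewrite fine_ge0.
pose q : R := 2^-1 `^ alpha.
have q01 : 0 < q < 1.
  have one : (1 : R) `^ alpha = 1 by rewrite powR1.
  rewrite powR_gt0 ?invr_gt0//= -[ltRHS]one gt0_ltr_powR ?nnegrE ?invr_ge0//.
  by rewrite invf_lt1// ltr1n.
have [q0 q1] := andP q01.
(* The square root of the bound in [sqnorm2_le_fourier] for M = J; the geometric ratio [q] is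
   2^{-alpha}. *)
pose K0 := Num.sqrt (8 * J) / (2 * pi).
have K00 : 0 <= K0 by rewrite divr_ge0 ?sqrtr_ge0// mulr_ge0// pi_ge0.
have mpow : measurable_fun setT (fun z : R => `|z| `^ alpha).
  have mp : measurable_fun setT (fun x : R => x `^ alpha) by exact: measurable_powR.
  exact: (measurableT_comp mp).
have iRe := assumption_S_integrable_Re psiS psi_cont.
have iIm := assumption_S_integrable_Im psiS psi_cont.
apply: (@geometric_bound_lty _ _ (K0 * L * C_S Phi) q) => //.
- by apply: mulr_ge0 => //; apply: mulr_ge0.
- move=> j; rewrite !mule_ge0 ?lee_fin ?powR_ge0//.
  (* The supremum is nonnegative because it dominates the member k = 0. *)
  apply: le_trans (ereal_sup_ubound (ex_intro2 _ _ 0 _ erefl)) => //.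
  exact: sqrte_ge0.
- move=> j; pose nj : R := 2 `^ (j%:R / 2); pose l : R := 2 ^+ j.
  have nj0 : 0 <= nj by exact: powR_ge0.
  have l0 : 0 < l by rewrite exprn_gt0.
  (* Cj = L 2^{-j/2} 2^{-j alpha}: the first power comes from the dilation, the second from
     evaluating psi^ at z / 2^j, so [W] majorises the transform of every psi_jk. *)
  pose Cj := nj / l * (L * l^-1 `^ alpha).
  have Cj0 : 0 <= Cj by rewrite !mulr_ge0 ?powR_ge0// invr_ge0 ltW.
  pose W (z : R) := Cj * `|z| `^ alpha.
  (* Since [nj * nj = l], the weight 2^{j/2} of the series cancels the 2^{-j/2} in [Cj] and leaves
     q^j. *)
  have -> : K0 * L * C_S Phi * q ^+ j = K0 * Cj * nj * C_S Phi.
    rewrite /Cj /q -powR_dyadicV -/l.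
    have -> : K0 * (nj / l * (L * l^-1 `^ alpha)) * nj * C_S Phi =
      K0 * L * C_S Phi * l^-1 `^ alpha * (nj * nj / l) by ring.
    by rewrite /nj dyadic_scale_sq -/l divff ?gt_eqF// mulr1.
  rewrite 2!EFinM; apply: lee_wpmul2r; first by rewrite lee_fin.
  apply: lee_wpmul2r; first by rewrite lee_fin.
  apply: ub_ereal_sup => _ [k _ <-].
  apply: sqrte_le; first exact: mulr_ge0.
  (* [W] enters the weighted integral of R^ twice, so that integral is Cj^2 J. *)
  have -> : (K0 * Cj) ^+ 2 = 8 * (Cj ^+ 2 * J) / (2 * pi) ^+ 2.
    rewrite exprMn /K0 exprMn exprVn sqr_sqrtr; last by rewrite mulr_ge0.
    by ring.
  apply: (sqnorm2_le_fourier Xsq Rcont Rint _ _ _ (eta_def j k) (W := W) (B := nj * Phi 0)).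
  - exact: continuous_dyadic_Re.
  - exact: continuous_dyadic_Im.
  - by move=> x; rewrite normc_dyadic ler_wpM2l ?powR_ge0// (assumption_S_bounded psiS).
  - exact: measurable_funM.
  - by move=> z; rewrite /W normrN.
  - move=> z; rewrite normc_fourier_dyadic// /W /Cj -/nj -/l -[leRHS]mulrA ler_wpM2l//.
      by rewrite divr_ge0// ltW.
    rewrite (le_trans (psiW _))// -mulrA ler_wpM2l// normrM powRM// mulrC.
    by rewrite gtr0_norm ?invr_gt0.
  - exact: integrable_dyadic_Re.
  - exact: integrable_dyadic_Im.
  - rewrite EFinM -IJ -ge0_integralZl//; last 3 first.
    + apply/measurable_EFinP; apply: measurable_funM.
        apply: measurable_funM; first exact: measurable_cabs_fourier2.
        exact: (measurableT_comp mpow).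
      exact: (measurableT_comp mpow).
    + move=> zw _; rewrite lee_fin !mulr_ge0 ?powR_ge0//.
      by rewrite normc_ReIm sqrtr_ge0.
    + by rewrite lee_fin sqr_ge0.
    rewrite le_eqVlt; apply/orP; left; apply/eqP; apply: eq_integral => zw _.
    by rewrite -EFinM; congr EFin; rewrite /W; ring.
Qed.
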